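(* Let the standing assumptions (i)–(v) and the solvability assumption of the context hold, and let $f$ be convex. Run GA-BPGc (described in the context) and put $\mathcal U_\phi=\operatorname{cl}\Omega\cap\operatorname{dom}\Phi\cap\operatorname{dom}\phi$. After $N\ge 1$ completed iterations, for every $u\in\mathcal U_\phi$, $$\Phi(y_N)-\Phi(u)\le \frac{2D_\phi(u,z_0)}{\left(\sum_{k=1}^N\sqrt{\lambda_k/\kappa_k}\right)^2}.$$ If a minimizer $x^\star\in\operatorname{cl}\Omega$ of $\Phi$ over $\operatorname{cl}\Omega$ belongs to $\operatorname{dom}\phi$, this holds with $u=x^\star$ and bounds the optimality gap $\Phi(y_N)-\Phi^\star$. In particular, in that case, if $\lambda_k/\kappa_k\ge c>0$ for all $k$, then $\Phi(y_N)-\Phi^\star=O(N^{-2})$. Moreover, for the Burg–entropy geometry $\psi(x)=-\sum_j\log x_j$ (on $\Omega=\{x\in\mathbb R^n:x_j>0\ \forall j\}$), $\phi(x)=\sum_j(x_j\log x_j-x_j)$, if every sublevel set $\{x\in\operatorname{cl}\Omega:\Phi(x)\le r\}$, $r\in\mathbb R$, is bounded and $\Phi$ has a minimizer over $\operatorname{cl}\Omega$ lying in $\Omega$, then $\sup_k\kappa_k<\infty$ and $\Phi(y_k)-\Phi^\star=O(k^{-2})$.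
   Context: Notation. $\langle\cdot,\cdot\rangle$ and $\|\cdot\|$ are the Euclidean inner product and norm on $\mathbb R^n$. For $h:\mathbb R^n\to(-\infty,+\infty]$, $\operatorname{dom}h=\{h<+\infty\}$ and $h^*$ is the convex conjugate. A proper lower semicontinuous convex function is Legendre if it is essentially smooth and essentially strictly convex; then $\nabla h^*=(\nabla h)^{-1}$ on $\operatorname{int}\operatorname{dom}h^*$. For $v$ where $h$ is differentiable, $D_h(u,v)=h(u)-h(v)-\langle\nabla h(v),u-v\rangle$ (possibly $+\infty$ when $h(u)=+\infty$); the same notation is used for $f$. Entropy uses $0\log 0=0$; Burg and entropy functions are $+\infty$ where not defined. Standing assumptions. (i) $\psi:\mathbb R^n\to(-\infty,+\infty]$ is Legendre and $\Omega=\operatorname{int}\operatorname{dom}\psi$ (nonempty open convex). (ii) $f:\mathbb R^n\to(-\infty,+\infty]$ is proper, lower semicontinuous, $\operatorname{dom}\psi\subset\operatorname{dom}f$, and $f$ is continuously differentiable on $\Omega$. (iii) $\rho:\mathbb R^n\to(-\infty,+\infty]$ is proper, lower semicontinuous, convex, with $\Omega\cap\operatorname{dom}\rho\ne\emptyset$. (iv) There is $L>0$ with $D_f(u,v)\le L D_\psi(u,v)$ for all $u,v\in\Omega$. (v) With $\Phi=f+\rho$, $\Phi^\star=\inf_{x\in\operatorname{cl}\Omega}\Phi(x)>-\infty$. BPG map. For $x\in\Omega$, $\lambda>0$, $$T_\lambda(x)=\operatorname{argmin}_{u\in\operatorname{cl}\Omega}\{\rho(u)+\langle\nabla f(x),u-x\rangle+\lambda^{-1}D_\psi(u,x)\}.$$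 Solvability assumption: $T_\lambda(x)\neq\emptyset$ for every $x\in\Omega$, $\lambda>0$ (the minimizer is then unique and lies in $\Omega$). For $\widehat y\in T_\lambda(x)$ put $g_\lambda(x)=(\nabla\psi(x)-\nabla\psi(\widehat y))/\lambda$ and $P_\lambda(x)=\lambda^{-1}[D_\psi(x,\widehat y)+D_\psi(\widehat y,x)]-D_f(\widehat y,x)$. GA-BPGc. Inputs: a Legendre function $\phi:\mathbb R^n\to(-\infty,+\infty]$; $y_0\in\Omega\cap\operatorname{dom}\rho\cap\operatorname{int}\operatorname{dom}\phi$; $\lambda_0,\kappa_0>0$; $\gamma_+\ge1$; $\gamma_-,\gamma_\kappa>1$. Set $z_0=y_0$, $\omega_0=0$. For $k=1,2,\dots$: if $y_{k-1}\in T_{\lambda_{k-1}}(y_{k-1})$, stop and return $y_{k-1}$. Otherwise set $\lambda=\gamma_+\lambda_{k-1}$, $\kappa=\kappa_{k-1}/\gamma_+$ and repeat trials: (a) $\alpha=(\lambda+\sqrt{\lambda^2+2\kappa\lambda\omega_{k-1}})/\kappa$, $\omega=\omega_{k-1}+\alpha$ (so $\kappa\alpha^2=2\lambda\omega$), $x=(\omega_{k-1}y_{k-1}+\alpha z_{k-1})/\omega$; (b) $\widehat y\in T_\lambda(x)$; if $\widehat y=x$, stop and return $x$; (c) if $D_f(\widehat y,x)>\lambda^{-1}D_\psi(\widehat y,x)$, replace $\lambda$ by $\lambda/\gamma_-$ and go to (a); (d) $p=\nabla\phi(z_{k-1})-\alpha g_\lambda(x)$; if $p\notin\operatorname{int}\operatorname{dom}\phi^*$,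 replace $\kappa$ by $\gamma_\kappa\kappa$ and go to (a); (e) $\widehat z=\nabla\phi^*(p)$; if $\widehat z\notin\Omega$ or $D_\phi(z_{k-1},\widehat z)>\omega P_\lambda(x)+\omega_{k-1}D_f(y_{k-1},x)$, replace $\kappa$ by $\gamma_\kappa\kappa$ and go to (a); (f) otherwise accept: $(\alpha_k,\omega_k,x_k,y_k,z_k,\lambda_k,\kappa_k)=(\alpha,\omega,x,\widehat y,\widehat z,\lambda,\kappa)$. An iteration is completed when a trial is accepted; sequences are indexed by completed iterations. *)

(* Defs.v *)
From HB Require Import structures.
From mathcomp Require Import all_boot all_order all_algebra.
From mathcomp Require Import all_classical all_reals all_analysis.
Set Implicit Arguments.
Unset Strict Implicit.
Unset Printing Implicit Defensive.
Import Order.TTheory GRing.Theory Num.Theory.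
Import numFieldNormedType.Exports.
Local Open Scope classical_set_scope.
Local Open Scope ring_scope.

(* The ambient space is 'rV[R]_n.  The library norm on it is the sup norm; it is
   used only for the topology and for boundedness, where the choice of norm on
   R^n is immaterial. *)

Section ConvexAnalysis.
Context {R : realType} {n : nat}.
Implicit Types (h : 'rV[R]_n -> \bar R) (x y u v p : 'rV[R]_n).

Definition dot u v : R := \sum_(j < n) u ord0 j * v ord0 j.

Definition enorm u : R := Num.sqrt (dot u u).

Definition dom h : set 'rV[R]_n := [set x | (h x < +oo)%E].

Definition proper h : Prop :=
  (forall x, h x != -oo%E) /\ (exists x, dom h x).

Definition convex_efun h : Prop := forall x y (t : R), 0 <= t <= 1 ->
  (h (t *: x + (1 - t) *: y)%R <= t%:E * h x + (1 - t)%:E * h y)%E.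

Definition conjugate h p : \bar R :=
  ereal_sup (range (fun x => (dot x p)%:E - h x)%E).

(* [h] is differentiable at [x]: it is finite near [x], and its real-valued
   restriction is Frechet differentiable there. *)
Definition ediff h x : Prop :=
  (\forall y \near x, h y \is a fin_num) /\ differentiable (fine \o h) x.

(* Meaningful only where [ediff h x] holds. *)
Definition grad h x : 'rV[R]_n :=
  \row_(j < n) 'D_(delta_mx ord0 j) (fine \o h) x.

Definition subdiff h x : set 'rV[R]_n :=
  [set g | forall y, (h x + (dot g (y - x))%:E <= h y)%E].

Definition essentially_smooth h : Prop :=
  [/\ (dom h)° !=set0,
      forall x, (dom h)° x -> ediff h x
    & forall (s : nat -> 'rV[R]_n) x,
        (forall i, (dom h)° (s i)) ->
        (closure (dom h)° `\` (dom h)°) x ->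
        s i @[i --> \oo] --> x ->
        enorm (grad h (s i)) @[i --> \oo] --> +oo].

Definition strictly_convex_on (C : set 'rV[R]_n) h : Prop :=
  forall x y (t : R), C x -> C y -> x != y -> 0 < t < 1 ->
  (h (t *: x + (1 - t) *: y)%R < t%:E * h x + (1 - t)%:E * h y)%E.

Definition essentially_strictly_convex h : Prop :=
  forall C : set 'rV[R]_n,
    convex_set (C : set (convex_lmodType 'rV[R]_n)) ->
    C `<=` [set x | subdiff h x !=set0] ->
    strictly_convex_on C h.

Definition Legendre h : Prop :=
  [/\ proper h, lower_semicontinuous h, convex_efun h, essentially_smooth h
    & essentially_strictly_convex h].

(* D_h(u, v); meaningful when [ediff h v] holds, possibly +oo. *)
Definition bregman h u v : \bar R :=
  (h u - h v - (dot (grad h v) (u - v)%R)%:E)%E.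

Definition burg x : \bar R :=
  if [forall j, 0 < x ord0 j] then (- \sum_(j < n) ln (x ord0 j))%:E
  else +oo%E.

(* [ln 0 = 0] in the library, so that 0 log 0 = 0 as required. *)
Definition entropy x : \bar R :=
  if [forall j, 0 <= x ord0 j]
  then (\sum_(j < n) (x ord0 j * ln (x ord0 j) - x ord0 j))%:E
  else +oo%E.

End ConvexAnalysis.

Section Setting.
Context {R : realType} {n : nat}.
Variables psi f rho : 'rV[R]_n -> \bar R.

Definition Omega : set 'rV[R]_n := (dom psi)°.

Definition Phi (x : 'rV[R]_n) : \bar R := (f x + rho x)%E.

Definition Phi_star : \bar R := ereal_inf [set Phi x | x in closure Omega].

Definition is_minimizer (xs : 'rV[R]_n) : Prop :=
  closure Omega xs /\ forall x, closure Omega x -> (Phi xs <= Phi x)%E.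

Record standing_assumptions : Prop := {
  psi_Legendre : Legendre psi;
  f_proper : proper f;
  f_lsc : lower_semicontinuous f;
  dom_psi_f : dom psi `<=` dom f;
  f_diff : forall x, Omega x -> ediff f x;
  f_C1 : forall x, Omega x -> {for x, continuous (grad f)};
  rho_proper : proper rho;
  rho_lsc : lower_semicontinuous rho;
  rho_convex : convex_efun rho;
  Omega_dom_rho : Omega `&` dom rho !=set0;
  f_relatively_smooth : exists2 L : R, 0 < L &
    forall u v, Omega u -> Omega v ->
      (bregman f u v <= L%:E * bregman psi u v)%E;
  Phi_star_bounded : (-oo < Phi_star)%E }.

Definition bpg_objective (lam : R) (x u : 'rV[R]_n) : \bar R :=
  (rho u + (dot (grad f x) (u - x)%R)%:E + (lam^-1)%:E * bregman psi u x)%E.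

Definition bpg_map (lam : R) (x : 'rV[R]_n) : set 'rV[R]_n :=
  [set u | closure Omega u /\ forall v, closure Omega v ->
     (bpg_objective lam x u <= bpg_objective lam x v)%E].

Definition solvable : Prop :=
  forall x (lam : R), Omega x -> 0 < lam -> bpg_map lam x !=set0.

(* g_lam(x) and P_lam(x), with the point [yh] of T_lam(x) made explicit. *)
Definition bpg_residual (lam : R) (x yh : 'rV[R]_n) : 'rV[R]_n :=
  lam^-1 *: (grad psi x - grad psi yh).

Definition bpg_progress (lam : R) (x yh : 'rV[R]_n) : \bar R :=
  ((lam^-1)%:E * (bregman psi x yh + bregman psi yh x) - bregman f yh x)%E.

End Setting.

(* What iteration k passes to iteration k + 1.  The values alpha_k and x_k are
   functions of the previous iterate and of (lambda_k, kappa_k): see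
   [trial_alpha] and [trial_x]. *)
Record iterate (R : realType) (n : nat) := Iterate {
  it_y : 'rV[R]_n; it_z : 'rV[R]_n;
  it_omega : R; it_lam : R; it_kap : R }.

Section Algorithm.
Context {R : realType} {n : nat}.
Variables psi f rho phi : 'rV[R]_n -> \bar R.
Variables gam_p gam_m gam_k : R.
Implicit Types (s : iterate R n) (lam kap : R) (yh : 'rV[R]_n).

Definition trial_alpha s lam kap : R :=
  (lam + Num.sqrt (lam ^+ 2 + 2 * kap * lam * it_omega s)) / kap.

Definition trial_omega s lam kap : R := it_omega s + trial_alpha s lam kap.

Definition trial_x s lam kap : 'rV[R]_n :=
  (trial_omega s lam kap)^-1 *:
    (it_omega s *: it_y s + trial_alpha s lam kap *: it_z s).

(* If yh = x the algorithm stops, so that no trial can continue from there. *)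
Definition trial_point s lam kap yh : Prop :=
  bpg_map psi f rho lam (trial_x s lam kap) yh /\ yh <> trial_x s lam kap.

(* The next three predicates are the acceptance conditions; the algorithm tests
   their negations, in this order. *)
Definition smooth_test s lam kap yh : Prop :=
  let x := trial_x s lam kap in
  (bregman f yh x <= (lam^-1)%:E * bregman psi yh x)%E.

Definition trial_dual s lam kap yh : 'rV[R]_n :=
  grad phi (it_z s)
  - trial_alpha s lam kap *: bpg_residual psi lam (trial_x s lam kap) yh.

Definition dual_test s lam kap yh : Prop :=
  (dom (conjugate phi))° (trial_dual s lam kap yh).

Definition trial_z s lam kap yh : 'rV[R]_n :=
  grad (conjugate phi) (trial_dual s lam kap yh).

Definition mirror_test s lam kap yh : Prop :=
  let x := trial_x s lam kap in
  let zh := trial_z s lam kap yh in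
  Omega psi zh /\
  (bregman phi (it_z s) zh <=
     (trial_omega s lam kap)%:E * bpg_progress psi f lam x yh
     + (it_omega s)%:E * bregman f (it_y s) x)%E.

(* The pairs (lambda, kappa) tried by the inner loop started from [s]. *)
Inductive tried s : R -> R -> Prop :=
| tried_first : tried s (gam_p * it_lam s) (it_kap s / gam_p)
| tried_smooth lam kap yh :
    tried s lam kap -> trial_point s lam kap yh ->
    ~ smooth_test s lam kap yh ->
    tried s (lam / gam_m) kap
| tried_dual lam kap yh :
    tried s lam kap -> trial_point s lam kap yh ->
    smooth_test s lam kap yh -> ~ dual_test s lam kap yh ->
    tried s lam (gam_k * kap)
| tried_mirror lam kap yh :
    tried s lam kap -> trial_point s lam kap yh ->
    smooth_test s lam kap yh -> dual_test s lam kap yh ->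
    ~ mirror_test s lam kap yh ->
    tried s lam (gam_k * kap).

(* A completed iteration from [s] to [s']; the first conjunct negates the
   stopping test made on entering the iteration. *)
Definition ga_step s s' : Prop :=
  let lam := it_lam s' in let kap := it_kap s' in let yh := it_y s' in
  ~ bpg_map psi f rho (it_lam s) (it_y s) (it_y s) /\
  [/\ tried s lam kap, trial_point s lam kap yh, smooth_test s lam kap yh,
      dual_test s lam kap yh & mirror_test s lam kap yh] /\
  it_z s' = trial_z s lam kap yh /\ it_omega s' = trial_omega s lam kap.

(* [len = Some K]: the first K iterations of a run (it may stop, or loop
   forever in trials, afterwards); [len = None]: infinitely many iterations are
   completed. *)
Definition completed (len : option nat) (k : nat) : bool :=
  if len is Some K then (k <= K)%N else true.

Definition ga_run (y0 : 'rV[R]_n) (lam0 kap0 : R) (len : option nat)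
    (st : nat -> iterate R n) : Prop :=
  st 0%N = Iterate y0 y0 0 lam0 kap0 /\
  forall k, completed len k.+1 -> ga_step (st k) (st k.+1).

End Algorithm.

Record ga_inputs {R : realType} {n : nat} (psi rho phi : 'rV[R]_n -> \bar R)
    (y0 : 'rV[R]_n) (lam0 kap0 gam_p gam_m gam_k : R) : Prop := {
  phi_Legendre : Legendre phi;
  y0_in : (Omega psi `&` dom rho `&` (dom phi)°) y0;
  lam0_gt0 : 0 < lam0;
  kap0_gt0 : 0 < kap0;
  gam_p_ge1 : 1 <= gam_p;
  gam_m_gt1 : 1 < gam_m;
  gam_k_gt1 : 1 < gam_k }.

Section Rates.
Context {R : realType} {n : nat}.

Definition rate_bound (phi : 'rV[R]_n -> \bar R) (st : nat -> iterate R n)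
    (N : nat) (u : 'rV[R]_n) : \bar R :=
  (2%:E * bregman phi u (it_z (st 0%N))
   * (((\sum_(1 <= k < N.+1) Num.sqrt (it_lam (st k) / it_kap (st k))) ^+ 2)^-1)%:E)%E.

(* e_k = O(k^-2) along the completed iterations. *)
Definition bigO_inv_sq (len : option nat) (e : nat -> \bar R) : Prop :=
  exists C : R, forall k, (0 < k)%N -> completed len k ->
    (`|e k| <= (C / k%:R ^+ 2)%:E)%E.

End Rates.

(* Main.v *)
Require Import Defs.
From mathcomp Require Import all_boot all_order all_algebra.
From mathcomp Require Import all_classical all_reals all_analysis.
From mathcomp Require Import ring lra.
Set Implicit Arguments.
Unset Strict Implicit.
Unset Printing Implicit Defensive.
Import Order.TTheory GRing.Theory Num.Theory.
Import numFieldNormedType.Exports.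
Local Open Scope classical_set_scope.
Local Open Scope ring_scope.

(** The rate comes from the Lyapunov function
    [omega_k * (Phi(y_k) - Phi(u)) + D_phi(u, z_k)], which does not increase
    ([ga_step_lyapunov]).  The descent inequality of the proximal step
    ([bpg_descent]), weighted by [omega_{k-1}] at [y_{k-1}] and by [alpha_k] at
    [u], leaves the linear term [alpha <g, z_{k-1} - u>]; since
    [grad phi(z_k) = grad phi(z_{k-1}) - alpha g], the three-point identity turns
    it into a difference of Bregman distances to [u] plus
    [D_phi(z_{k-1}, z_k)], and the mirror test pays for the latter.  On the other
    hand [kap alpha^2 = 2 lam omega] makes [sqrt (2 omega_k)] grow by at least
    [sqrt (lam_k / kap_k)] per iteration ([ga_step_sqrt_omega]).

    Two facts of convex analysis are needed.  For a Legendre function,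
    [grad phi^*(p)] is an interior point at which [grad phi] equals [p]
    ([Legendre_grad_conjugate]), and a proximal point lies in [Omega]
    ([bpg_map_Omega]).  Both rest on [interior_of_slope]: an essentially smooth
    convex function has no finite slope from a boundary point of its domain
    towards the interior.

    In the Burg-entropy geometry with an interior minimizer [xs], everything
    stays in a compact subset of the open orthant.  For the mirror points this
    follows from the bound on [D_phi(xs, z_k)].  The proximal step does not
    increase [D_psi(xs, .)] ([trial_fejer]), and neither does the
    convex combination of [y_{k-1}] and [z_{k-1}] that defines the trial point,
    except below a fixed level ([burg_div_mix]).  So [D_psi(xs, .)] is bounded on
    all iterates and trial points.  On a compact set the two sides of the mirror
    test are both quadratic in [alpha g], with an extra factor [kap] on the right
    ([mirror_test_of_large_kappa]): the test succeeds once [kap] is large, so that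
    [kap_k] is bounded.  Relative smoothness keeps [lam_k] away from zero
    ([lam_bounded_below]), and the ratio [lam_k / kap_k] is bounded below. *)

(** * Inner product and one-sided slopes *)

Section InnerProduct.
Context {R : realType} {n : nat}.
Implicit Types (u v w p : 'rV[R]_n) (a : R).

Lemma dotC u v : dot u v = dot v u.
Proof. by apply: eq_bigr => j _; rewrite mulrC. Qed.

Lemma dotDr u v w : dot u (v + w) = dot u v + dot u w.
Proof. by rewrite -big_split; apply: eq_bigr => j _; rewrite mxE mulrDr. Qed.

Lemma dotZr a u v : dot u (a *: v) = a * dot u v.
Proof. by rewrite mulr_sumr; apply: eq_bigr => j _; rewrite mxE mulrCA. Qed.

Lemma dotNr u v : dot u (- v) = - dot u v.
Proof. by rewrite -scaleN1r dotZr mulN1r. Qed.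

Lemma dotBr u v w : dot u (v - w) = dot u v - dot u w.
Proof. by rewrite dotDr dotNr. Qed.

Lemma dotDl u v w : dot (u + v) w = dot u w + dot v w.
Proof. by rewrite dotC dotDr !(dotC w). Qed.

Lemma dotZl a u v : dot (a *: u) v = a * dot u v.
Proof. by rewrite dotC dotZr dotC. Qed.

Lemma dotNl u v : dot (- u) v = - dot u v.
Proof. by rewrite dotC dotNr dotC. Qed.

Lemma dotBl u v w : dot (u - v) w = dot u w - dot v w.
Proof. by rewrite dotDl dotNl. Qed.

Lemma dot_delta u j : dot u (delta_mx ord0 j) = u ord0 j.
Proof.
rewrite /dot (bigD1 j)//= mxE !eqxx mulr1 big1 ?addr0// => i /negPf ij.
by rewrite mxE eqxx ij mulr0.
Qed.

Definition dotE := (dotDl, dotDr, dotNl, dotNr, dotZl, dotZr).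

End InnerProduct.

Section DirectionalDerivatives.
Context {R : realType} {n : nat}.
Implicit Types (v d p : 'rV[R]_n) (F : 'rV[R]_n -> R) (h : 'rV[R]_n -> \bar R).

Lemma near_line (P : set 'rV[R]_n) v d :
  nbhs v P -> \forall t \near (0 : R), P (v + t *: d).
Proof.
move=> Pv.
have c : (fun t : R => v + t *: d) @ (0 : R) --> v.
  rewrite [X in _ --> X](_ : v = v + 0 *: d); last by rewrite scale0r addr0.
  by apply: cvgD; [exact: cvg_cst | apply: cvgZr_tmp; exact: cvg_id].
exact: c.
Qed.

Lemma near_ray (P : set 'rV[R]_n) v d :
  nbhs v P -> \forall t \near (0 : R)^'+, P (v + t *: d).
Proof. by move=> /(@near_line _ v d); exact: cvg_within. Qed.

Lemma dot_gradE F v d : differentiable F v ->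
  dot (\row_(j < n) 'D_(delta_mx ord0 j) F v) d = 'D_d F v.
Proof.
move=> dF; rewrite deriveE// [in RHS](row_sum_delta d) linear_sum /=.
by apply: eq_bigr => j _; rewrite mxE deriveE// linearZ /= mulrC.
Qed.

Lemma derive_ray F v d : differentiable F v ->
  (fun t : R => t^-1 * (F (v + t *: d) - F v)) @ 0^'+
    --> dot (\row_(j < n) 'D_(delta_mx ord0 j) F v) d.
Proof.
move=> dF; rewrite dot_gradE//.
have /cvg_dnbhs_at_right : (fun t : R => t^-1 *: (F (t *: d + v) - F v)) @ 0^'
    --> 'D_d F v by exact: diff_derivable.
by under [X in X @ _ --> _]eq_fun do rewrite [_ *: d + v]addrC.
Qed.

(** An affine bound on the increments along a ray needs to hold for small positive
    times only; [ge_dot_grad] is the opposite bound. *)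
Lemma le_dot_grad h v d (c : R) : ediff h v ->
  (\forall t \near 0^'+, c * t <= fine (h (v + t *: d)) - fine (h v)) ->
  c <= dot (grad h v) d.
Proof.
move=> [_ dh] hc; rewrite /grad; apply: (cvgr_to_ge (derive_ray dh)); near=> t.
have t0 : 0 < t by near: t; exact: nbhs_right_gt.
by rewrite ler_pdivlMl// mulrC; near: t; exact: hc.
Unshelve. all: by end_near. Qed.

Lemma ge_dot_grad h v d (c : R) : ediff h v ->
  (\forall t \near 0^'+, fine (h (v + t *: d)) - fine (h v) <= c * t) ->
  dot (grad h v) d <= c.
Proof.
move=> [_ dh] hc; rewrite /grad; apply: (cvgr_to_le (derive_ray dh)); near=> t.
have t0 : 0 < t by near: t; exact: nbhs_right_gt.
by rewrite ler_pdivrMl// mulrC; near: t; exact: hc.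
Unshelve. all: by end_near. Qed.

End DirectionalDerivatives.

(** * Convex functions and essential smoothness *)

Section ConvexFunctions.
Context {R : realType} {n : nat}.
Variable h : 'rV[R]_n -> \bar R.
Hypothesis h_ninf : forall x, h x != -oo%E.
Hypothesis h_cvx : convex_efun h.
Implicit Types (x y z u v d p : 'rV[R]_n) (t r : R).

Lemma dom_fin x : dom h x -> h x \is a fin_num.
Proof. by rewrite /dom /= fin_numE h_ninf lt_neqAle => /andP[]. Qed.

Lemma fin_dom x : h x \is a fin_num -> dom h x.
Proof. by rewrite /dom /= ltey fin_numE => /andP[]. Qed.

Lemma ediff_fin v : ediff h v -> h v \is a fin_num.
Proof. by move=> [/nbhs_singleton]. Qed.

(** Convexity is used through the real-valued increments along a segment, which
    is the form that one-sided slope estimates consume. *)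
Lemma convex_ray x y t : h x \is a fin_num -> h y \is a fin_num ->
  0 <= t <= 1 ->
  h (y + t *: (x - y)) \is a fin_num /\
  fine (h (y + t *: (x - y))) <= fine (h y) + t * (fine (h x) - fine (h y)).
Proof.
move=> hx hy t01.
have -> : y + t *: (x - y) = t *: x + (1 - t) *: y.
  by rewrite scalerBr scalerBl scale1r addrCA.
have := h_cvx x y t01; rewrite -(fineK hx) -(fineK hy) -!EFinM -EFinD => le.
have fin : h (t *: x + (1 - t) *: y) \is a fin_num.
  by apply: dom_fin; exact: le_lt_trans le (ltry _).
split=> //; rewrite -lee_fin (fineK fin); apply: le_trans le _.
by rewrite lee_fin /=; nra.
Qed.

Lemma convex_grad u v : ediff h v -> h u \is a fin_num ->
  dot (grad h v) (u - v) <= fine (h u) - fine (h v).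
Proof.
move=> dv hu; have hv := ediff_fin dv.
apply: ge_dot_grad => //; near=> t.
have t0 : 0 <= t by near: t; exact: nbhs_right_ge.
have t1 : t <= 1 by near: t; exact: nbhs_right_le.
have [|_] := convex_ray (t := t) hu hv; first exact/andP.
by rewrite mulrC; lra.
Unshelve. all: by end_near. Qed.

(** A subgradient bounds all directional slopes from below; applying this to
    opposite directions makes it the gradient. *)
Lemma subgrad_grad z p : ediff h z ->
  (forall x, h x \is a fin_num ->
     fine (h z) + dot p (x - z) <= fine (h x)) ->
  grad h z = p.
Proof.
move=> dz sub.
have le d : dot p d <= dot (grad h z) d.
  apply: le_dot_grad => //; near=> t.
  have := sub (z + t *: d); rewrite addrAC subrr add0r dotZr.
  have hzt : h (z + t *: d) \is a fin_num.
    by near: t; apply: (near_ray (P := [set w | h w \is a fin_num])); case: dz.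
  by move=> /(_ hzt); rewrite mulrC; lra.
apply/rowP => j; rewrite -!dot_delta; apply/le_anti/andP; split; last exact: le.
by rewrite -lerN2 -!dotNr; exact: le.
Unshelve. all: by end_near. Qed.

(** The homothety of centre [z] and ratio [t] maps a ball around [x] inside the
    domain to a ball around the new point. *)
Lemma interior_ray z x t : dom h z -> (dom h)° x -> 0 < t <= 1 ->
  (dom h)° (z + t *: (x - z)).
Proof.
move=> /dom_fin hz hx /andP[t0 t1]; rewrite /interior /=.
have /nbhs_normP[e /= e0 he] : nbhs x (dom h) := hx.
apply/(@nbhs_normP _ _ (z + t *: (x - z)) (dom h)).
exists (t * e) => /=; first exact: mulr_gt0.
move=> w /= wt; pose w' := z + t^-1 *: (w - z).
have /dom_fin hw : dom h w'.
  apply: he => /=; have -> : x - w' = t^-1 *: (z + t *: (x - z) - w).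

    by rewrite /w'; apply/rowP => k; rewrite !mxE; field; rewrite gt_eqF.
  by rewrite normrZ gtr0_norm ?invr_gt0// ltr_pdivrMl.
have [|fin _] := convex_ray (t := t) hw hz; first by rewrite ltW.
apply: fin_dom; move: fin; rewrite /w' [_ - z]addrAC subrr add0r scalerA.
by rewrite mulfV ?gt_eqF// scale1r addrC subrK.
Qed.

(** At a boundary point of its domain an essentially smooth convex function
    descends infinitely steeply into the interior: were the slope towards an
    interior point [x] bounded below by [- C], the gradients along that segment
    would be bounded, because the gradient inequality at each of them can be
    tested against a full neighbourhood of [x]. *)
Lemma interior_of_slope z x (C : R) : essentially_smooth h ->
  dom h z -> (dom h)° x -> 0 <= C ->
  (forall t, 0 < t <= 1 ->
     fine (h z) - C * t <= fine (h (z + t *: (x - z)))) ->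
  (dom h)° z.
Proof.
move=> [_ hdiff hblow] hz hx C0 slope; apply: contrapT => zbd.
pose pt t : 'rV[R]_n := z + t *: (x - z).
have hzf := dom_fin hz.
have pt_int t : 0 < t <= 1 -> (dom h)° (pt t) by exact: interior_ray.
have g_ray t : 0 < t <= 1 -> - C <= dot (grad h (pt t)) (x - z).
  move=> t01; have := convex_grad (hdiff _ (pt_int _ t01)) hzf.
  rewrite /pt opprD addrA subrr sub0r dotNr dotZr.
  by case/andP: t01 (slope _ t01) => t0 _; nra.
have bound j : exists K : R, forall t, 0 < t <= 1 -> `|grad h (pt t) ord0 j| <= K.
  pose e : 'rV[R]_n := delta_mx ord0 j.
  have [r [r0 [fp fm]]] : exists r, 0 < r /\
      (dom h (x + r *: e) /\ dom h (x + r *: - e)).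
    have : \forall r \near 0^'+, 0 < r /\
        (dom h (x + r *: e) /\ dom h (x + r *: - e)).
      near=> r; split; first by near: r; exact: nbhs_right_gt.
      by split; near: r; apply: (near_ray (P := dom h)).
    exact: filter_ex.
  pose M w := fine (h w) - fine (h z) + 2 * C.
  (* The gradient inequality at [pt t], tested at [x + w], with the component
     of [x + w - pt t] along [x - z] controlled by [g_ray]. *)
  have ub t w : 0 < t <= 1 -> dom h (x + w) ->
      dot (grad h (pt t)) w <= M (x + w).
    move=> t01 /dom_fin fw; have := convex_grad (hdiff _ (pt_int _ t01)) fw.
    have -> : x + w - pt t = w + (1 - t) *: (x - z).
      apply/rowP => k; rewrite !mxE; ring.
    rewrite dotDr dotZr /M; have := slope _ t01; have := g_ray _ t01.
    by rewrite -/(pt t); case/andP: t01 => t0 t1; nra.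
  exists ((`|M (x + r *: e)| + `|M (x + r *: - e)|) / r) => t t01.
  have := ub _ _ t01 fp; have := ub _ _ t01 fm.
  rewrite scalerN dotNr dotZr dot_delta -scalerN.
  move: (M (x + r *: e)) (M (x + r *: - e)) => a b.
  have := ler_norm a; have := ler_norm b; have := normr_ge0 a.
  have := normr_ge0 b; rewrite ler_pdivlMr// => *.
  by rewrite -[X in _ * X](gtr0_norm r0) -normrM ler_norml; lra.
have [K gK] := choice bound.
pose s (i : nat) := pt (i.+1%:R^-1).
have s01 i : 0 < (i.+1%:R^-1 : R) <= 1.
  by rewrite invr_gt0 ltr0n /= invf_le1 ?ltr0n// ler1n.
have sz : s i @[i --> \oo] --> z.
  rewrite [X in _ --> X](_ : z = z + 0 *: (x - z)); last by rewrite scale0r addr0.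
  apply: cvgD; first exact: cvg_cst.
  by apply: cvgZr_tmp; exact: cvg_harmonic.
have clz : closure (dom h)° z.
  move=> B zB; have [i Bi] : exists i, B (s i).
    by exact: (filter_ex (F := \oo) (sz _ zB)).
  by exists (s i); split=> //; exact: pt_int.
have := hblow s z (fun i => pt_int _ (s01 i)) (conj clz zbd) sz.
move/cvgryPgt => /(_ (Num.sqrt (\sum_j K j ^+ 2))) /filter_ex[i] /=.
rewrite ltNge => /negP; apply; apply: ler_wsqrtr; apply: ler_sum => j _.
rewrite -expr2 -real_normK ?num_real// ler_sqr ?nnegrE ?normr_ge0 ?gK//.
exact: le_trans (normr_ge0 _) (gK j _ (s01 i)).
Unshelve. all: by end_near. Qed.

End ConvexFunctions.

(** * Legendre duality *)

Section LegendreDuality.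
Context {R : realType} {n : nat}.
Implicit Types (x y z d p q : 'rV[R]_n) (t r : R).

Lemma dot_continuous p : continuous (fun x => dot x p).
Proof.
rewrite /dot; elim: (index_enum _) => [|j s IH].
  rewrite (_ : (fun x => _) = cst 0); first exact: cst_continuous.
  by apply/funext => x; rewrite big_nil.
rewrite (_ : (fun x => _) =
    (fun x => x ord0 j * p ord0 j + \sum_(j <- s) x ord0 j * p ord0 j)); last first.
  by apply/funext => x; rewrite big_cons.
move=> x; pose f (y : 'rV[R]_n) := y ord0 j.
have cf : f @ x --> f x by exact: coord_continuous.
have cp : (fun=> p ord0 j) @ x --> p ord0 j by exact: cst_continuous.
exact: (cvgD (cvgM cf cp) (IH x)).
Qed.

Variable phi : 'rV[R]_n -> \bar R.
Hypothesis phiL : Legendre phi.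

Let phi_ninf : forall x, phi x != -oo%E.
Proof. by case: phiL => -[]. Qed.

Let phi_cvx : convex_efun phi.
Proof. by case: phiL. Qed.

Local Notation c := (conjugate phi).

Lemma conjugate_ge x p : ((dot x p)%:E - phi x <= c p)%E.
Proof. by apply: ereal_sup_ubound; exists x. Qed.

Lemma conjugate_fin p : dom c p -> c p \is a fin_num.
Proof.
move=> cp; rewrite fin_numE; apply/andP; split; last by rewrite -ltey.
case: phiL => -[_ [x /(dom_fin phi_ninf) fx]] _ _ _ _.
by have := conjugate_ge x p; rewrite -(fineK fx) -EFinB; case: (c p).
Qed.

Lemma Fenchel_Young x p : phi x \is a fin_num -> dom c p ->
  dot x p - fine (phi x) <= fine (c p).
Proof.
move=> fx /conjugate_fin fc; rewrite -lee_fin (fineK fc).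
by have := conjugate_ge x p; rewrite -{1}(fineK fx) -EFinB.
Qed.

(** A maximizing sequence for the conjugate stays bounded, since the conjugate
    is finite at [p +/- r e_j] and so controls each coordinate; lower
    semicontinuity then keeps the value in the limit. *)
Lemma conjugate_attained (K : set 'rV[R]_n) p : (dom c)° p -> closed K ->
  (forall mu : R, mu < fine (c p) -> exists x,
     [/\ K x, phi x \is a fin_num & mu <= dot x p - fine (phi x)]) ->
  exists x, [/\ K x, phi x \is a fin_num & dot x p - fine (phi x) = fine (c p)].
Proof.
move=> cp Kcl Kmax.
have cpd : dom c p by exact: nbhs_singleton cp.
(* The superlevel sets [G mu] generate a proper filter; its cluster point in the
   box that contains them is the maximizer. *)
pose G (mu : R) : set 'rV[R]_n :=
  [set x | [/\ K x, phi x \is a fin_num & mu <= dot x p - fine (phi x)]].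
pose D : set R := [set mu | mu < fine (c p)].
have DG : ProperFilter (filter_from D G).
  apply: filter_from_proper => [|mu /Kmax[x Gx]]; last by exists x.
  apply: filter_from_filter; first by exists (fine (c p) - 1); rewrite /D /=; lra.
  move=> a b Da Db; exists (Num.max a b); first by rewrite /D /= gt_max Da.
  by move=> x [Kx fx]; rewrite ge_max => /andP[ax bx].
have bound j : exists M : R, forall x, G (fine (c p) - 1) x ->
    x ord0 j \in `[- M, M].
  pose e : 'rV[R]_n := delta_mx ord0 j.
  have [r [r0 [rp rm]]] : exists r, 0 < r /\
      (dom c (p + r *: e) /\ dom c (p + r *: - e)).
    have : \forall r \near 0^'+, 0 < r /\
        (dom c (p + r *: e) /\ dom c (p + r *: - e)).
      near=> r; split; first by near: r; exact: nbhs_right_gt.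
      by split; near: r; apply: (near_ray (P := dom c)).
    exact: filter_ex.
  pose N q := fine (c q) - fine (c p) + 1.
  exists ((`|N (p + r *: e)| + `|N (p + r *: - e)|) / r) => x [_ fx xp].
  have := Fenchel_Young fx rp; have := Fenchel_Young fx rm.
  rewrite !dotE dot_delta -/e => h1 h2.
  have b1 : r * x ord0 j <= N (p + r *: e) by rewrite /N; lra.
  have b2 : - (r * x ord0 j) <= N (p + r *: - e) by rewrite /N; lra.
  have := le_trans b1 (ler_norm _); have := le_trans b2 (ler_norm _).
  have := normr_ge0 (N (p + r *: e)); have := normr_ge0 (N (p + r *: - e)).
  rewrite in_itv /= -ler_norml ler_pdivlMr// => *.
  rewrite -[X in _ * X](gtr0_norm r0) -normrM ler_norml.
  by apply/andP; split; lra.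
have [M GM] := choice bound.
have box : compact [set x : 'rV[R]_n | forall j, x ord0 j \in `[- M j, M j]].
  apply: (rV_compact (A := fun j => `[- M j, M j]%classic)) => j.
  exact: segment_compact.
have [x [_ xcl]] : [set x : 'rV[R]_n | forall j, x ord0 j \in `[- M j, M j]]
    `&` cluster (filter_from D G) !=set0.
  apply: box; exists (fine (c p) - 1); first by rewrite /D /=; lra.
  by move=> x Gx j; exact: GM.
have Kx : K x.
  apply: Kcl => B xB; have [||y [[Ky _ _] By]] := xcl (G (fine (c p) - 1)) B.
  - by exists (fine (c p) - 1) => //; rewrite /D /=; lra.
  - exact: xB.
  - by exists y.
(* Otherwise some [a] separates [phi x] from [dot x p - mu], and by lower
   semicontinuity it does so near [x], away from [G mu]. *)
have le_mu mu : mu < fine (c p) -> (phi x <= (dot x p - mu)%:E)%E.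
  move=> Dmu; rewrite leNgt; apply/negP => lt_phi.
  have [a /andP[a1 a2]] : exists a : R,
      (dot x p - mu < a) && (a%:E < phi x)%E.
    case: (phi x) (phi_ninf x) lt_phi => [s _|_ _|//].
      rewrite lte_fin => lts; exists ((dot x p - mu + s) / 2).
      by rewrite lte_fin; lra.
    by exists (dot x p - mu + 1); rewrite ltry andbT; lra.
  have [V xV Va] : exists2 V, nbhs x V & forall y, V y -> (a%:E < phi y)%E.
    by case: phiL => _ /(_ x a a2).
  have xW : \forall y \near x, dot y p < mu + a.
    by apply: (cvgr_lt _ (@dot_continuous p x)); lra.
  have [||y [[_ fy hy] [Vy Wy]]] :=
      xcl (G mu) (V `&` [set y | dot y p < mu + a]).
  - by exists mu.
  - exact: filterI.
  - by have := Va y Vy; rewrite -(fineK fy) lte_fin; move: Wy hy => /=; lra.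
have fx : phi x \is a fin_num.
  apply: dom_fin => //; apply: le_lt_trans (le_mu (fine (c p) - 1) _) (ltry _).
  lra.
exists x; split=> //; apply/le_anti/andP; split; first exact: Fenchel_Young.
apply/ler_addgt0Pr => e e0.
have := le_mu (fine (c p) - e); rewrite -{1}(fineK fx) lee_fin.
by move=> /(_ ltac:(lra)); lra.
Unshelve. all: by end_near. Qed.

(** Two maximizers would span a segment of subdifferentiability points along
    which [phi] is affine, against essential strict convexity. *)
Lemma conjugate_argmax_uniq x y p : dom c p ->
  phi x \is a fin_num -> phi y \is a fin_num ->
  dot x p - fine (phi x) = fine (c p) ->
  dot y p - fine (phi y) = fine (c p) -> x = y.
Proof.
move=> cp fx fy hx hy.
pose C : set 'rV[R]_n :=
  [set x | phi x \is a fin_num /\ dot x p - fine (phi x) = fine (c p)].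
have Cc : convex_set (C : set (convex_lmodType 'rV[R]_n)).
  move=> u v l; rewrite !inE => -[fu hu] [fv hv].
  have l01 : 0 <= l%:num <= (1 : R) by rewrite ge0 le1.
  have -> : conv l u v = v + l%:num *: (u - v).
    transitivity (l%:num *: (u : 'rV[R]_n) + (1 - l%:num) *: (v : 'rV[R]_n)) => //.
    by rewrite scalerBr scalerBl scale1r addrCA.
  have [fw hw] := convex_ray phi_ninf phi_cvx fu fv l01.
  split=> //; apply/le_anti/andP; split; first exact: Fenchel_Young.
  by move: hw; rewrite !dotE; nra.
have Cs : C `<=` [set x | subdiff phi x !=set0].
  move=> u [fu hu]; exists p => v; rewrite -(fineK fu).
  have [fv|] := boolP (phi v \is a fin_num); last first.
    by rewrite fin_numE phi_ninf /= negbK => /eqP ->; rewrite leey.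
  rewrite -(fineK fv) -EFinD lee_fin (dotC p) !dotE.
  by have := Fenchel_Young fv cp; lra.
apply/eqP/negPn/negP => neq.
have := phiL; case=> _ _ _ _ /(_ C Cc Cs x y (2^-1)).
have h01 : 0 < (2^-1 : R) < 1 by lra.
move=> /(_ (conj fx hx) (conj fy hy) neq h01); apply/negP; rewrite -leNgt.
rewrite -(fineK fx) -(fineK fy) -!EFinM -EFinD.
pose w := 2^-1 *: x + (1 - 2^-1) *: y; rewrite -/w.
have wE : dot w p = 2^-1 * dot x p + (1 - 2^-1) * dot y p.
  by rewrite /w !dotE.
have [fw|] := boolP (phi w \is a fin_num); last first.
  by rewrite fin_numE phi_ninf /= negbK => /eqP ->; rewrite leey.
rewrite -(fineK fw) lee_fin; have := Fenchel_Young fw cp.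
rewrite wE /=; lra.
Qed.

End LegendreDuality.

Section GradientOfConjugate.
Context {R : realType} {n : nat}.
Implicit Types (x y z d p q : 'rV[R]_n).
Variable phi : 'rV[R]_n -> \bar R.
Hypothesis phiL : Legendre phi.
Local Notation c := (conjugate phi).

Let phi_ninf : forall x, phi x != -oo%E.
Proof. by case: phiL => -[]. Qed.

Let phi_cvx : convex_efun phi.
Proof. by case: phiL. Qed.

(** Points [x] with [dot x d] at least [dot z d + e] stay a positive gap below
    the maximum defining [c p]; a small move along [d] cannot close that gap, so
    the remaining points control [c] there. *)
Lemma conjugate_slope z d p (e : R) : (dom c)° p ->
  phi z \is a fin_num -> dot z p - fine (phi z) = fine (c p) -> 0 < e ->
  exists2 r : R, 0 < r & forall t, 0 < t <= r ->
    fine (c p) + t * dot z d <= fine (c (p + t *: d))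
      <= fine (c p) + t * (dot z d + e).
Proof.
move=> cp fz hz e0; have cpd : dom c p by exact: nbhs_singleton cp.
pose K : set 'rV[R]_n := [set x | dot z d + e <= dot x d].
have Kcl : closed K.
  by apply: (closed_comp (fun x _ => @dot_continuous _ _ d x) (@closed_ge _ _)).
have [S [Slt HS]] : exists S, S < fine (c p) /\ forall x, K x ->
    phi x \is a fin_num -> dot x p - fine (phi x) <= S.
  apply: contrapT => noS.
  have [mu mult|x [Kx fx hx]] := conjugate_attained phiL cp Kcl.
    apply: contrapT => nox; apply: noS; exists mu; split=> // x Kx fx.
    rewrite leNgt; apply/negP => lt; apply: nox.
    by exists x; split=> //; exact: ltW.
  move: Kx; rewrite /K /= (conjugate_argmax_uniq phiL cpd fx fz hx hz); lra.
have [r [r0 rd]] : exists r, 0 < r /\ dom c (p + r *: d).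
  have : \forall r \near 0^'+, 0 < r /\ dom c (p + r *: d).
    near=> r; split; first by near: r; exact: nbhs_right_gt.
    by near: r; apply: (near_ray (P := dom c)).
  exact: filter_ex.
(* On [K] the value at [p + t *: d] lies below the chord from [S] at [t = 0] to
   [c (p + r *: d)] at [t = r], whose slope is [A]; up to time
   [gap / (`|A - B| + 1)] the chord stays below the target of slope [B]. *)
pose A := (fine (c (p + r *: d)) - S) / r; pose B := dot z d + e.
pose gap := fine (c p) - S.
have gap0 : 0 < gap by rewrite /gap; lra.
exists (Num.min r (gap / (`|A - B| + 1))).
  rewrite lt_min r0 divr_gt0//; have := normr_ge0 (A - B); lra.
move=> t /andP[t0]; rewrite le_min => /andP[tr].
have AB1 : 0 < `|A - B| + 1 by have := normr_ge0 (A - B); lra.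
rewrite ler_pdivlMr// => tgap.
have ub x : phi x \is a fin_num ->
    dot x (p + t *: d) - fine (phi x) <= fine (c p) + t * B.
  move=> fx; have := Fenchel_Young phiL fx cpd.
  have := Fenchel_Young phiL fx rd; rewrite !dotE.
  have [xK|] := lerP B (dot x d); last by rewrite /B; nra.
  have := HS x xK fx.
  pose s := t / r; have ts : t = s * r by rewrite /s divfK// gt_eqF.
  have Ar : A * r = fine (c (p + r *: d)) - S by rewrite /A divfK// gt_eqF.
  have s0 : 0 <= s by rewrite divr_ge0// ltW.
  have s1 : s <= 1 by rewrite /s ler_pdivrMr// mul1r.
  have tAB : t * (A - B) <= gap.
    by apply: le_trans tgap; rewrite ler_pM2l//; have := ler_norm (A - B); lra.
  move: tAB; rewrite /gap ts; move: (fine (c (p + r *: d))) Ar => C2 Ar.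
  move: (dot x p) (dot x d) (fine (phi x)) (fine (c p)) => a w b cp0 tAB vS rS cS.
  have := mulr_ge0 s0 (_ : 0 <= C2 - (a + r * w - b)).
  have : 0 <= (1 - s) * (S - (a - b)) by apply: mulr_ge0; lra.
  have : s * (A * r) = s * (C2 - S) by rewrite Ar.
  nra.
have cle : (c (p + t *: d) <= (fine (c p) + t * B)%:E)%E.
  apply: ge_ereal_sup => _ [x _ <-].
  have [fx|] := boolP (phi x \is a fin_num).
    by rewrite -(fineK fx) -EFinB lee_fin; exact: ub.
  by rewrite fin_numE phi_ninf /= negbK => /eqP ->; rewrite leNye.
have cd : dom c (p + t *: d) by exact: le_lt_trans cle (ltry _).
apply/andP; split; last by rewrite -lee_fin (fineK (conjugate_fin phiL cd)).
by have := Fenchel_Young phiL fz cd; rewrite !dotE; lra.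
Unshelve. all: by end_near. Qed.

(** [grad] is read off the partial derivatives of [c], and each of them is the
    common value of two one-sided slopes given by [conjugate_slope]. *)
Lemma grad_conjugate z p : (dom c)° p -> phi z \is a fin_num ->
  dot z p - fine (phi z) = fine (c p) -> grad c p = z.
Proof.
move=> cp fz hz; apply/rowP => j; rewrite mxE /derive.
pose e : 'rV[R]_n := delta_mx ord0 j.
apply: cvg_lim => //; apply/cvgrPdist_le => eps eps0.
have [r1 r10 h1] := conjugate_slope e cp fz hz eps0.
have [r2 r20 h2] := conjugate_slope (- e) cp fz hz eps0.
near=> t; have t0 : t != 0 by near: t; exact: nbhs_dnbhs_neq.
have : `|t| <= Num.min r1 r2 by near: t; apply: dnbhs0_le; rewrite lt_min r10.
rewrite le_min => /andP[tr1 tr2] /=; rewrite [t *: _ + p]addrC -/e.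
move: h1 h2; rewrite dotNr !dot_delta => h1 h2.
rewrite -(ler_pM2l (_ : 0 < `|t|)) ?normr_gt0// -normrM mulrBr mulVKf//.
have [tp|tn|/eqP] := ltgtP t 0; last by rewrite (negPf t0).
  rewrite (ltr0_norm tp) in tr2 *.
  have := h2 (- t); rewrite scalerN scaleNr opprK oppr_gt0 tp tr2 => /(_ isT).
  by move=> /andP[l1 l2]; rewrite ler_norml; apply/andP; split; nra.
rewrite (gtr0_norm tn) in tr1 *; have := h1 t; rewrite tn tr1 => /(_ isT).
by move=> /andP[l1 l2]; rewrite ler_norml; apply/andP; split; nra.
Unshelve. all: by end_near. Qed.

(** The gradient of the conjugate is the maximizer of [dot x p - phi x]; at that
    point [p] is a subgradient, hence a lower bound on slopes, which essential
    smoothness forbids on the boundary, and in the interior the only subgradient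
    is the gradient. *)
Theorem Legendre_grad_conjugate p : (dom c)° p ->
  (dom phi)° (grad c p) /\ grad phi (grad c p) = p.
Proof.
move=> cp; have cpd : dom c p by exact: nbhs_singleton cp.
have [mu mult|z [_ fz hz]] := conjugate_attained phiL cp closedT.
  have /ereal_sup_gt[_ [x _ <-]] : (mu%:E < c p)%E.
    by rewrite -(fineK (conjugate_fin phiL cpd)) lte_fin.
  have [fx|] := boolP (phi x \is a fin_num).
    rewrite -{1}(fineK fx) -EFinB lte_fin => mux.
    by exists x; split=> //; exact: ltW.
  by rewrite fin_numE phi_ninf /= negbK => /eqP ->.
rewrite (grad_conjugate cp fz hz).
have sub x : phi x \is a fin_num -> fine (phi z) + dot p (x - z) <= fine (phi x).
  by move=> fx; have := Fenchel_Young phiL fx cpd; rewrite (dotC p) !dotE; lra.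
have [_ _ _ phi_es _] := phiL; have [[x0 x0int] phi_diff _] := phi_es.
have x0d : dom phi x0 by exact: nbhs_singleton x0int.
have zint : (dom phi)° z.
  apply: (interior_of_slope phi_ninf phi_cvx (x := x0)
    (C := `|dot p (x0 - z)|)) => // [|t /andP[t0 t1]]; first exact: fin_dom.
  have t01 : 0 <= t <= 1 by rewrite ltW.
  have [ft _] := convex_ray phi_ninf phi_cvx (dom_fin phi_ninf x0d) fz t01.
  have := sub _ ft; rewrite addrAC subrr add0r dotZr.
  have := ler_norm (- dot p (x0 - z)); rewrite normrN; nra.
by split=> //; exact: subgrad_grad (phi_diff _ zint) sub.
Qed.

End GradientOfConjugate.

(** * The Bregman proximal gradient step *)

Section BregmanProximalStep.
Context {R : realType} {n : nat}.
Implicit Types (x y z u v d p yh : 'rV[R]_n) (lam : R).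

(** Real-valued form of [bregman], equal to it wherever both function values are
    finite: the algebra of the Lyapunov argument is carried out in [R]. *)
Definition rbregman (h : 'rV[R]_n -> \bar R) u v : R :=
  fine (h u) - fine (h v) - dot (grad h v) (u - v).

Lemma bregmanE (h : 'rV[R]_n -> \bar R) u v :
  h u \is a fin_num -> h v \is a fin_num ->
  bregman h u v = (rbregman h u v)%:E.
Proof. by move=> hu hv; rewrite /bregman -(fineK hu) -(fineK hv). Qed.

Variables psi f rho : 'rV[R]_n -> \bar R.
Hypothesis SA : standing_assumptions psi f rho.

Definition rPhi x : R := fine (f x) + fine (rho x).

Definition rprogress lam x yh : R :=
  lam^-1 * (rbregman psi x yh + rbregman psi yh x) - rbregman f yh x.

Lemma psi_ninf x : psi x != -oo%E.
Proof. by case: (psi_Legendre SA) => -[]. Qed.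

Lemma psi_cvx : convex_efun psi.
Proof. by case: (psi_Legendre SA). Qed.

Lemma f_ninf x : f x != -oo%E.
Proof. by case: (f_proper SA). Qed.

Lemma rho_ninf x : rho x != -oo%E.
Proof. by case: (rho_proper SA). Qed.

Lemma psi_diff x : Omega psi x -> ediff psi x.
Proof. by case: (psi_Legendre SA) => _ _ _ [_ + _] _; exact. Qed.

Lemma psi_fin x : Omega psi x -> psi x \is a fin_num.
Proof. by move=> /psi_diff/ediff_fin. Qed.

Lemma f_fin x : Omega psi x -> f x \is a fin_num.
Proof. by move=> /(f_diff SA)/ediff_fin. Qed.

Lemma bpg_objectiveE lam x u : psi x \is a fin_num ->
  psi u \is a fin_num -> rho u \is a fin_num ->
  bpg_objective psi f rho lam x u =
    (fine (rho u) + dot (grad f x) (u - x) + lam^-1 * rbregman psi u x)%:E.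
Proof.
move=> fx fu fr; rewrite /bpg_objective bregmanE// -(fineK fr).
by rewrite -EFinM -!EFinD.
Qed.

Lemma bpg_objective_dom lam x u : 0 < lam -> psi x \is a fin_num ->
  (bpg_objective psi f rho lam x u < +oo)%E -> dom rho u /\ dom psi u.
Proof.
move=> lam0 fx; rewrite /bpg_objective /bregman /dom /= -(fineK fx).
have l0 : (0 < (lam^-1)%:E)%E by rewrite lte_fin invr_gt0.
have [psiu|] := eqVneq (psi u) +oo%E.
  rewrite psiu /= gt0_muley//.
  by case: (rho u) (rho_ninf u).
rewrite -ltey => psiu obj; split=> //; move: obj.
rewrite -(fineK (dom_fin psi_ninf psiu)).
rewrite -!EFinB -EFinM; case: (rho u) (rho_ninf u) => [r||]// _; rewrite ?ltry//.
Qed.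

Variables (lam : R) (x yh : 'rV[R]_n).
Hypotheses (lam0 : 0 < lam) (Ox : Omega psi x).
Hypothesis Tyh : bpg_map psi f rho lam x yh.

Lemma bpg_map_dom : dom rho yh /\ dom psi yh.
Proof.
have [x0 [Ox0 /(dom_fin rho_ninf) rx0]] := Omega_dom_rho SA.
apply: (bpg_objective_dom lam0 (psi_fin Ox)).
have [_ /(_ x0 (subset_closure Ox0))] := Tyh.
rewrite (bpg_objectiveE lam (psi_fin Ox) (psi_fin Ox0) rx0) => /le_lt_trans.
by apply; exact: ltry.
Qed.

(** Minimality bounds the slope of [psi] at [yh] from below towards a point of
    the open set [Omega psi] where [rho] is finite. *)
Lemma bpg_map_Omega : Omega psi yh.
Proof.
have [ry py] := bpg_map_dom.
have ryf := dom_fin rho_ninf ry; have pyf := dom_fin psi_ninf py.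
have [x0 [Ox0 rx0]] := Omega_dom_rho SA; have rx0f := dom_fin rho_ninf rx0.
have [_ _ _ es _] := psi_Legendre SA.
pose d := x0 - yh.
pose C := lam * (fine (rho x0) - fine (rho yh) + dot (grad f x) d)
          - dot (grad psi x) d.
apply: (interior_of_slope psi_ninf psi_cvx (x := x0) (C := `|C|)) => //.
move=> t /andP[t0 t1]; have t01 : 0 <= t <= 1 by rewrite ltW.
have Op : Omega psi (yh + t *: d).
  by apply: (interior_ray psi_ninf psi_cvx) => //; rewrite t0.
have [rpf rp] := convex_ray rho_ninf (rho_convex SA) rx0f ryf t01.
have [_ /(_ _ (subset_closure Op))] := Tyh.
rewrite (bpg_objectiveE lam (psi_fin Ox) pyf ryf).
rewrite (bpg_objectiveE lam (psi_fin Ox) (psi_fin Op) rpf).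
rewrite lee_fin /rbregman -/d -(ler_pM2l lam0) !mulrDr !mulVKf ?gt_eqF//.
rewrite !dotE -/d; have := ler_norm C; rewrite {1}/C; move: rp; rewrite -/d.
rewrite !dotE => /(ler_wpM2l (ltW lam0)) + /(ler_wpM2l (ltW t0)); lra.
Qed.

Lemma bpg_map_rho_fin : rho yh \is a fin_num.
Proof. by case: bpg_map_dom => /(dom_fin rho_ninf). Qed.

(** Compare [yh] with points of the segment towards [u]: convexity of [rho] bounds
    its increments, and the derivative of [psi] at [yh] gives the linear term. *)
Lemma bpg_optimality u : rho u \is a fin_num ->
  dot (bpg_residual psi lam x yh - grad f x) (u - yh)
    <= fine (rho u) - fine (rho yh).
Proof.
move=> ru; have Oy := bpg_map_Omega; have ry := bpg_map_rho_fin.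
pose d := u - yh.
have : lam * (fine (rho yh) - fine (rho u) - dot (grad f x) d)
    + dot (grad psi x) d <= dot (grad psi yh) d.
  apply: le_dot_grad; first exact: psi_diff.
  near=> t.
  have Op : Omega psi (yh + t *: d).
    near: t; apply: (near_ray (P := Omega psi)).
    by apply: open_nbhs_nbhs; split=> //; exact: open_interior.
  have t0 : 0 < t by near: t; exact: nbhs_right_gt.
  have t1 : t <= 1 by near: t; exact: nbhs_right_le.
  have t01 : 0 <= t <= 1 by rewrite ltW.
  have [rpf rp] := convex_ray rho_ninf (rho_convex SA) ru ry t01.
  have [_ /(_ _ (subset_closure Op))] := Tyh.
  rewrite (bpg_objectiveE lam (psi_fin Ox) (psi_fin Oy) ry).
  rewrite (bpg_objectiveE lam (psi_fin Ox) (psi_fin Op) rpf).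
  rewrite lee_fin /rbregman -/d -(ler_pM2l lam0) !mulrDr !mulVKf ?gt_eqF//.
  by have := ler_wpM2l (ltW lam0) rp; rewrite -/d !dotE; lra.
rewrite /bpg_residual -/d dotBl dotZl dotBl => opt.
by rewrite lerBlDr ler_pdivrMl//; nra.
Unshelve. all: by end_near. Qed.

(** The terms of [f] are exact, by definition of [D_f]; [rho] is handled by
    optimality of [yh], and [P] appears through the identity
    [<g, x - yh> = (D_psi(x, yh) + D_psi(yh, x)) / lam]. *)
Lemma bpg_descent u : f u \is a fin_num -> rho u \is a fin_num ->
  rPhi yh - rPhi u <= dot (bpg_residual psi lam x yh) (x - u)
    - rprogress lam x yh - rbregman f u x.
Proof.
move=> fu ru; have := bpg_optimality ru.
rewrite /rPhi /rprogress /rbregman.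
have -> : u - yh = (x - yh) - (x - u) by apply/rowP => k; rewrite !mxE; ring.
rewrite -!(opprB x) !dotNr.
set g := bpg_residual _ _ _ _.
have : dot g (x - yh) =
    lam^-1 * (dot (grad psi x) (x - yh) - dot (grad psi yh) (x - yh)).
  by rewrite dotZl dotBl.
rewrite !dotBr !dotBl.
lra.
Qed.

End BregmanProximalStep.

(** * Trials and accepted iterations *)

Section Iterations.
Context {R : realType} {n : nat}.
Variables psi f rho phi : 'rV[R]_n -> \bar R.
Variables gam_p gam_m gam_k : R.
Hypothesis SA : standing_assumptions psi f rho.
Hypothesis f_cvx : convex_efun f.
Hypothesis phiL : Legendre phi.
Hypotheses (gp1 : 1 <= gam_p) (gm1 : 1 < gam_m) (gk1 : 1 < gam_k).
Implicit Types (s : iterate R n) (u v yh : 'rV[R]_n) (lam kap : R).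

(** What the estimates on one iteration require of its starting state; it is
    preserved by accepted trials. *)
Definition admissible s :=
  [/\ Omega psi (it_y s), rho (it_y s) \is a fin_num,
      Omega psi (it_z s), (dom phi)° (it_z s)
    & [/\ 0 <= it_omega s, 0 < it_lam s & 0 < it_kap s]].

Lemma phi_diff z : (dom phi)° z -> ediff phi z.
Proof. by case: phiL => _ _ _ [_ + _] _; exact. Qed.

Lemma phi_fin z : (dom phi)° z -> phi z \is a fin_num.
Proof. by move=> /phi_diff/ediff_fin. Qed.

Lemma rbregman_ge0 (h : 'rV[R]_n -> \bar R) u v : (forall x, h x != -oo%E) ->
  convex_efun h -> ediff h v -> h u \is a fin_num -> 0 <= rbregman h u v.
Proof.
by move=> h_ninf h_cvx dv hu; rewrite subr_ge0; exact: convex_grad.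
Qed.

Lemma rbregman_three_points (h : 'rV[R]_n -> \bar R) u v w :
  rbregman h u v - rbregman h u w + rbregman h v w =
  dot (grad h v - grad h w) (v - u).
Proof. by rewrite /rbregman !dotE; ring. Qed.

Section Trial.
Variables (s : iterate R n) (lam kap : R).
Hypotheses (sA : admissible s) (lam0 : 0 < lam) (kap0 : 0 < kap).

Local Notation omega := (it_omega s).
Local Notation alpha := (trial_alpha s lam kap).
Local Notation omega' := (trial_omega s lam kap).
Local Notation x := (trial_x s lam kap).

Let omega_ge0 : 0 <= omega.
Proof. by case: sA => _ _ _ _ []. Qed.

Lemma trial_alpha_gt0 : 0 < alpha.
Proof.
by rewrite divr_gt0// ltr_wpDr// sqrtr_ge0.
Qed.

Lemma trial_omega_gt0 : 0 < omega'.
Proof. by rewrite ltr_wpDl// trial_alpha_gt0. Qed.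

(** [trial_alpha] is the positive root of this quadratic equation in [alpha]. *)
Lemma trial_alpha_sqr : kap * alpha ^+ 2 = 2 * lam * omega'.
Proof.
have lo : 0 <= kap * lam * omega by rewrite !mulr_ge0// ltW.
pose S := lam ^+ 2 + 2 * kap * lam * omega.
have : Num.sqrt S ^+ 2 = S by rewrite sqr_sqrtr// /S; have := sqr_ge0 lam; lra.
have : kap * alpha = lam + Num.sqrt S by rewrite mulrC divfK ?gt_eqF.
move: (Num.sqrt S) => q kE qS; apply: (mulfI (lt0r_neq0 kap0)).
rewrite /trial_omega.
have -> : kap * (kap * alpha ^+ 2) = (kap * alpha) ^+ 2 by ring.
have -> : kap * (2 * lam * (omega + alpha)) =
  2 * lam * (kap * omega) + 2 * lam * (kap * alpha) by ring.
rewrite kE; move: qS; rewrite /S; lra.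
Qed.

(** The trial point is on the segment from [it_y s] to [it_z s]; convexity then
    keeps it in [Omega psi]. *)
Lemma trial_xE : x = it_y s + (alpha / omega') *: (it_z s - it_y s).
Proof.
have := gt_eqF trial_omega_gt0; rewrite /trial_x /trial_omega => w0.
by apply/rowP => j; rewrite !mxE; field; rewrite w0.
Qed.

Lemma trial_tau : 0 < alpha / omega' <= 1.
Proof.
rewrite divr_gt0 ?trial_omega_gt0 ?trial_alpha_gt0//=.
by rewrite ler_pdivrMr ?trial_omega_gt0// mul1r lerDr.
Qed.

Lemma trial_x_Omega : Omega psi x.
Proof.
case: sA => /interior_subset Oy _ Oz _ _; rewrite trial_xE.
exact: (interior_ray (psi_ninf SA) (psi_cvx SA) Oy Oz trial_tau).
Qed.

Variable yh : 'rV[R]_n.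
Hypothesis tp : trial_point psi f rho s lam kap yh.

Lemma trial_yh_Omega : Omega psi yh.
Proof. by case: tp => Tyh _; exact: (bpg_map_Omega SA lam0 trial_x_Omega Tyh). Qed.

Lemma trial_yh_rho : rho yh \is a fin_num.
Proof.
by case: tp => Tyh _; exact: (bpg_map_rho_fin SA lam0 trial_x_Omega Tyh).
Qed.

(** The descent inequality at [u = it_y s] and at [u], with weights [omega] and
    [alpha]; the point [x] is their weighted mean of [it_y s] and [it_z s], so
    that only [it_z s - u] survives in the linear term. *)
Lemma trial_estimate u : f u \is a fin_num -> rho u \is a fin_num ->
  omega' * (rPhi f rho yh - rPhi f rho u)
    - omega * (rPhi f rho (it_y s) - rPhi f rho u)
  <= alpha * dot (bpg_residual psi lam x yh) (it_z s - u)
     - (omega' * rprogress psi f lam x yh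
        + omega * rbregman f (it_y s) x).
Proof.
move=> fu ru; case: sA => Oy ry _ _ _; case: tp => Tyh _.
have Ox := trial_x_Omega.
have := bpg_descent SA lam0 Ox Tyh (f_fin SA Oy) ry.
have := bpg_descent SA lam0 Ox Tyh fu ru.
have := rbregman_ge0 (f_ninf SA) f_cvx (f_diff SA Ox) fu.
have : omega' * dot (bpg_residual psi lam x yh) x =
    omega * dot (bpg_residual psi lam x yh) (it_y s)
    + alpha * dot (bpg_residual psi lam x yh) (it_z s).
  rewrite -!dotZr -dotDr /trial_x scalerA mulfV ?scale1r//.
  by rewrite gt_eqF// trial_omega_gt0.
rewrite /trial_omega !dotBr => xE /(mulr_ge0 (ltW trial_alpha_gt0)).
move=> Df /(ler_wpM2l (ltW trial_alpha_gt0)) + /(ler_wpM2l omega_ge0); lra.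
Qed.

Lemma mirror_testE : (dom phi)° (trial_z psi phi s lam kap yh) ->
  mirror_test psi f phi s lam kap yh <->
  Omega psi (trial_z psi phi s lam kap yh) /\
  rbregman phi (it_z s) (trial_z psi phi s lam kap yh)
    <= omega' * rprogress psi f lam x yh + omega * rbregman f (it_y s) x.
Proof.
move=> zh_int; rewrite /mirror_test.
case: sA => Oy _ _ z_int _; have Ox := trial_x_Omega; have Oyh := trial_yh_Omega.
rewrite (bregmanE (phi_fin z_int) (phi_fin zh_int)) /bpg_progress.
rewrite (bregmanE (psi_fin SA Ox) (psi_fin SA Oyh)).
rewrite (bregmanE (psi_fin SA Oyh) (psi_fin SA Ox)).
rewrite (bregmanE (f_fin SA Oyh) (f_fin SA Ox)).
rewrite (bregmanE (f_fin SA Oy) (f_fin SA Ox)).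
by rewrite /= lee_fin.
Qed.

Lemma smooth_testE : smooth_test psi f s lam kap yh <->
  rbregman f yh x <= lam^-1 * rbregman psi yh x.
Proof.
have Ox := trial_x_Omega; have Oyh := trial_yh_Omega.
rewrite /smooth_test (bregmanE (psi_fin SA Oyh) (psi_fin SA Ox)).
by rewrite (bregmanE (f_fin SA Oyh) (f_fin SA Ox)) -EFinM lee_fin.
Qed.

Lemma rprogress_ge : smooth_test psi f s lam kap yh ->
  lam^-1 * rbregman psi x yh <= rprogress psi f lam x yh.
Proof. by move=> /smooth_testE; rewrite /rprogress; lra. Qed.

(** The proximal step is Fejer monotone for [D_psi]: three points turn the
    descent inequality into a comparison of [D_psi u x] and [D_psi u yh]. *)
Lemma trial_fejer u : smooth_test psi f s lam kap yh ->
  f u \is a fin_num -> rho u \is a fin_num ->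
  rPhi f rho u <= rPhi f rho yh -> rbregman psi u yh <= rbregman psi u x.
Proof.
move=> /smooth_testE sm fu ru uyh; have Ox := trial_x_Omega.
have [Tyh _] := tp; have := bpg_descent SA lam0 Ox Tyh fu ru.
have := rbregman_ge0 (f_ninf SA) f_cvx (f_diff SA Ox) fu.
have := rbregman_three_points psi u x yh.
rewrite /bpg_residual dotZl => <-; move: sm; rewrite /rprogress => sm D0 dsc.
have : 0 <= lam^-1 * (rbregman psi u x - rbregman psi u yh) by lra.
by rewrite pmulr_rge0 ?invr_gt0// subr_ge0.
Qed.

End Trial.

Lemma tried_gt0 s lam kap : admissible s ->
  tried psi f rho phi gam_p gam_m gam_k s lam kap -> 0 < lam /\ 0 < kap.
Proof.
move=> [_ _ _ _ [_ l0 k0]].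
have gp0 : 0 < gam_p by exact: lt_le_trans ltr01 gp1.
have gm0 : 0 < gam_m by exact: lt_trans ltr01 gm1.
have gk0 : 0 < gam_k by exact: lt_trans ltr01 gk1.
elim=> [|l k yh _ [? ?] _ _|l k yh _ [? ?] _ _ _|l k yh _ [? ?] _ _ _ _].
- by rewrite mulr_gt0// divr_gt0.
- by rewrite divr_gt0.
- by rewrite mulr_gt0.
- by rewrite mulr_gt0.
Qed.

Lemma ga_step_admissible s s' : admissible s ->
  ga_step psi f rho phi gam_p gam_m gam_k s s' ->
  admissible s' /\ 0 < it_omega s'.
Proof.
move=> sA [_ [[tr tp _ dt mt] [zE wE]]].
have [l0 k0] := tried_gt0 sA tr.
have [zh_int _] := Legendre_grad_conjugate phiL dt.
rewrite /admissible zE wE l0 k0; case: mt => Ozh _.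
have w0 := trial_omega_gt0 sA l0 k0.
split=> //; split=> //; last by split=> //; exact: ltW.
  exact: trial_yh_Omega tp.
exact: trial_yh_rho tp.
Qed.

(** [grad phi] of the new mirror point is [grad phi (it_z s) - alpha g], so the
    linear term of the trial estimate is a three-point difference, and the
    mirror test absorbs what remains. *)
Lemma ga_step_lyapunov s s' u : admissible s ->
  ga_step psi f rho phi gam_p gam_m gam_k s s' ->
  f u \is a fin_num -> rho u \is a fin_num ->
  it_omega s' * (rPhi f rho (it_y s') - rPhi f rho u)
    + rbregman phi u (it_z s')
  <= it_omega s * (rPhi f rho (it_y s) - rPhi f rho u)
    + rbregman phi u (it_z s).
Proof.
move=> sA [_ [[tr tp _ dt mt] [zE wE]]] fu ru.
have [l0 k0] := tried_gt0 sA tr.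
have [zh_int zhE] := Legendre_grad_conjugate phiL dt.
have [_ {}mt] := (mirror_testE sA l0 k0 tp zh_int).1 mt.
have := trial_estimate sA l0 k0 tp fu ru.
rewrite zE wE; set zh := trial_z _ _ _ _ _ _ in mt *.
have := rbregman_three_points phi u (it_z s) zh.
have -> : grad phi zh = trial_dual psi phi s (it_lam s') (it_kap s') (it_y s').
  exact: zhE.
rewrite /trial_dual subKr dotZl; lra.
Qed.

(** With [a], [b] the square roots of [2 omega'], [2 omega] and [c] that of
    [lam / kap], the equation for [alpha] says [alpha = c * a], that is
    [a ^+ 2 - b ^+ 2 = 2 * c * a]; hence [(a - c) ^+ 2 >= b ^+ 2], where
    [a >= 2 * c]. *)
Lemma ga_step_sqrt_omega s s' : admissible s ->
  ga_step psi f rho phi gam_p gam_m gam_k s s' ->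
  Num.sqrt (2 * it_omega s) + Num.sqrt (it_lam s' / it_kap s')
    <= Num.sqrt (2 * it_omega s').
Proof.
move=> sA [_ [[tr _ _ _ _] [_ wE]]].
have [l0 k0] := tried_gt0 sA tr.
have [_ _ _ _ [w0 _ _]] := sA.
have w'0 := trial_omega_gt0 sA l0 k0.
have al0 := trial_alpha_gt0 s l0 k0.
have := trial_alpha_sqr sA l0 k0; rewrite wE.
set al := trial_alpha _ _ _ in al0 *; set w' := trial_omega _ _ _ in w'0 *.
have w'E : w' = it_omega s + al by [].
set a := Num.sqrt (2 * w'); set b := Num.sqrt _; set c := Num.sqrt (_ / _).
have a0 : 0 < a by rewrite sqrtr_gt0 mulr_gt0.
have b0 : 0 <= b by exact: sqrtr_ge0.
have c0 : 0 <= c by exact: sqrtr_ge0.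
have a2 : a ^+ 2 = 2 * w' by rewrite sqr_sqrtr// mulr_ge0// ltW.
have b2 : b ^+ 2 = 2 * it_omega s by rewrite sqr_sqrtr// mulr_ge0.
have c2 : it_kap s' * c ^+ 2 = it_lam s'.
  by rewrite sqr_sqrtr ?divr_ge0 ?ltW// mulrC divfK ?gt_eqF.
move=> alE.
have alac : al = c * a.
  apply/eqP; rewrite -(@eqrXn2 _ 2%N)//; last 2 first.
  - exact: ltW.
  - by rewrite mulr_ge0// ltW.
  apply/eqP/(mulfI (lt0r_neq0 k0)).
  by rewrite alE exprMn mulrA c2 a2; ring.
have ca : 2 * c <= a.
  rewrite -(ler_pM2r a0); have : 0 <= b ^+ 2 by exact: sqr_ge0.
  by rewrite b2; move: a2; rewrite w'E alac; lra.
rewrite -lerBrDr -(@ler_pXn2r _ 2%N)// ?nnegrE//; last lra.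
rewrite b2; have := sqr_ge0 c; move: a2; rewrite w'E alac; nra.
Qed.

End Iterations.

(** * Rates along a run *)

Section Runs.
Context {R : realType} {n : nat}.
Variables (psi f rho phi : 'rV[R]_n -> \bar R) (y0 : 'rV[R]_n).
Variables (lam0 kap0 gam_p gam_m gam_k : R).
Variables (len : option nat) (st : nat -> iterate R n).
Hypothesis SA : standing_assumptions psi f rho.
Hypothesis f_cvx : convex_efun f.
Hypothesis inputs : ga_inputs psi rho phi y0 lam0 kap0 gam_p gam_m gam_k.
Hypothesis run :
  ga_run psi f rho phi gam_p gam_m gam_k y0 lam0 kap0 len st.
Implicit Types (u : 'rV[R]_n) (k N : nat).

Let phiL := phi_Legendre inputs.
Let gp1 := gam_p_ge1 inputs.
Let gm1 := gam_m_gt1 inputs.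
Let gk1 := gam_k_gt1 inputs.

Lemma completed_pred k : completed len k.+1 -> completed len k.
Proof. by case: len => //= K; exact: ltnW. Qed.

Lemma run_step k : completed len k.+1 ->
  ga_step psi f rho phi gam_p gam_m gam_k (st k) (st k.+1).
Proof. by case: run => _; exact. Qed.

Lemma run_admissible k : completed len k -> admissible psi rho phi (st k).
Proof.
elim: k => [_|k IH kc].
  have [-> _] := run; have [[Oy ry] py] := y0_in inputs.
  split=> //=; first exact: (dom_fin (rho_ninf SA) ry).
  by split=> //; [exact: lam0_gt0 inputs | exact: kap0_gt0 inputs].
have sA := IH (completed_pred kc).
by case: (ga_step_admissible SA phiL gp1 gm1 gk1 sA (run_step kc)).
Qed.

Lemma run_omega_gt0 k : completed len k.+1 -> 0 < it_omega (st k.+1).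
Proof.
move=> kc; have sA := run_admissible (completed_pred kc).
by case: (ga_step_admissible SA phiL gp1 gm1 gk1 sA (run_step kc)).
Qed.

Lemma run_lyapunov k u : completed len k ->
  f u \is a fin_num -> rho u \is a fin_num ->
  it_omega (st k) * (rPhi f rho (it_y (st k)) - rPhi f rho u)
    + rbregman phi u (it_z (st k)) <= rbregman phi u (it_z (st 0%N)).
Proof.
move=> + fu ru; elim: k => [_|k IH kc].
  by have [-> _] := run; rewrite /= mul0r add0r.
have sA := run_admissible (completed_pred kc).
apply: le_trans (IH (completed_pred kc)).
exact: (ga_step_lyapunov SA f_cvx phiL gp1 gm1 gk1 sA (run_step kc) fu ru).
Qed.

Definition step_sum N : R :=
  \sum_(1 <= k < N.+1) Num.sqrt (it_lam (st k) / it_kap (st k)).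

Lemma step_sum_le N : completed len N ->
  step_sum N <= Num.sqrt (2 * it_omega (st N)).
Proof.
rewrite /step_sum; elim: N => [_|N IH Nc].
  by rewrite big_geq// sqrtr_ge0.
rewrite big_nat_recr//=.
have sA := run_admissible (completed_pred Nc).
have := ga_step_sqrt_omega gp1 gm1 gk1 sA (run_step Nc).
by apply: le_trans; rewrite lerD2r; exact: IH (completed_pred Nc).
Qed.

Lemma step_sum_ge (c : R) N : 0 <= c -> completed len N ->
  (forall k, (0 < k)%N -> completed len k ->
     c <= it_lam (st k) / it_kap (st k)) ->
  N%:R * Num.sqrt c <= step_sum N.
Proof.
move=> c0 + cle; rewrite /step_sum; elim: N => [_|N IH Nc].
  by rewrite mul0r big_geq.
rewrite big_nat_recr//= -natr1 mulrDl mul1r lerD//.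
  exact: IH (completed_pred Nc).
by apply: ler_wsqrtr; exact: cle.
Qed.

Lemma step_sum_gt0 N : (0 < N)%N -> completed len N -> 0 < step_sum N.
Proof.
case: N => // N _ Nc; rewrite /step_sum big_nat_recr//=.
have [_ _ _ _ [_ l0 k0]] := run_admissible Nc.
by rewrite ltr_wpDl ?sumr_ge0// sqrtr_gt0 divr_gt0.
Qed.

Lemma z0_bregman_ge0 u : phi u \is a fin_num ->
  0 <= rbregman phi u (it_z (st 0%N)).
Proof.
move=> pu; have [[phi_ninf _] _ phi_cvx _ _] := phiL.
have /run_admissible[_ _ _ z_int _] : completed len 0 by case: len.
exact: (rbregman_ge0 phi_ninf phi_cvx (phi_diff phiL z_int) pu).
Qed.

(** The Lyapunov inequality gives [omega_N * gap <= D_phi(u, z_0)], and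
    [omega_N] is at least half the square of [step_sum N]. *)
Lemma run_rate N u : (0 < N)%N -> completed len N ->
  f u \is a fin_num -> rho u \is a fin_num -> phi u \is a fin_num ->
  rPhi f rho (it_y (st N)) - rPhi f rho u
    <= 2 * rbregman phi u (it_z (st 0%N)) / step_sum N ^+ 2.
Proof.
move=> N0 Nc fu ru pu; have S0 := step_sum_gt0 N0 Nc.
have D0 := z0_bregman_ge0 pu.
have [_ _ _ z_int [w0 _ _]] := run_admissible Nc.
have [[phi_ninf _] _ phi_cvx _ _] := phiL.
have DN := rbregman_ge0 phi_ninf phi_cvx (phi_diff phiL z_int) pu.
have lyap := run_lyapunov Nc fu ru.
have S2 : step_sum N ^+ 2 <= 2 * it_omega (st N).
  rewrite -[leRHS](@sqr_sqrtr R) ?mulr_ge0//.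
  by rewrite ler_pXn2r ?nnegrE ?sqrtr_ge0 ?(ltW S0)//; exact: step_sum_le.
have S20 : 0 < step_sum N ^+ 2 by rewrite exprn_gt0.
rewrite ler_pdivlMr//; move: lyap S2; set d := _ - _.
have [d0|d0] := lerP d 0; first by nra.
by move=> ? /(ler_wpM2l (ltW d0)); lra.
Qed.

(** Relative smoothness makes every trial with [lam <= L^-1] pass the smoothness
    test, so backtracking never goes below [L^-1 / gam_m]. *)
Lemma lam_bounded_below : exists2 l : R, 0 < l &
  forall k, completed len k -> l <= it_lam (st k).
Proof.
have [L L0 smooth] := f_relatively_smooth SA.
have gm0 : 0 < gam_m by exact: lt_trans ltr01 gm1.
have [|_ _ _ _ [_ l00 _]] := @run_admissible 0%N; first by case: len.
pose l := Num.min (it_lam (st 0%N)) (L^-1 / gam_m).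
exists l; first by rewrite lt_min l00 divr_gt0// invr_gt0.
elim=> [_|k IH kc]; first by rewrite ge_min lexx.
have kc' := completed_pred kc; have sA := run_admissible kc'.
have [_ [[tr _ _ _ _] _]] := run_step kc.
elim: tr => [|la ka yh tr _ tp ns|//|//].
  apply: le_trans (IH kc') _; have [_ _ _ _ [_ lk0 _]] := sA.
  by rewrite ler_peMl ?(ltW lk0).
have [la0 ka0] := tried_gt0 gp1 gm1 gk1 sA tr.
rewrite ge_min; apply/orP; right; rewrite ler_pM2r ?invr_gt0//.
rewrite leNgt; apply/negP => laL; case: ns.
have Ox := trial_x_Omega SA sA la0 ka0.
have Oyh := trial_yh_Omega SA sA la0 ka0 tp.
apply/(smooth_testE SA sA la0 ka0 tp).
have := smooth _ _ Oyh Ox.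
rewrite (bregmanE (psi_fin SA Oyh) (psi_fin SA Ox)).
rewrite (bregmanE (f_fin SA Oyh) (f_fin SA Ox)) -EFinM lee_fin => /le_trans; apply.
apply: ler_wpM2r.
  exact: (rbregman_ge0 (psi_ninf SA) (psi_cvx SA) (psi_diff SA Ox) (psi_fin SA Oyh)).
by rewrite -[leLHS]invrK lef_pV2 ?posrE ?invr_gt0// ltW.
Qed.

Lemma PhiE x : f x \is a fin_num -> rho x \is a fin_num ->
  Phi f rho x = (rPhi f rho x)%:E.
Proof. by move=> fx rx; rewrite /Phi -(fineK fx) -(fineK rx). Qed.

Lemma dom_Phi u : dom (Phi f rho) u -> f u \is a fin_num /\ rho u \is a fin_num.
Proof.
rewrite /dom /Phi /=; have := f_ninf SA u; have := rho_ninf SA u.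
by case: (f u) => [a||]; case: (rho u).
Qed.

Lemma Phi_iterate k : completed len k ->
  Phi f rho (it_y (st k)) = (rPhi f rho (it_y (st k)))%:E.
Proof. by move=> /run_admissible[Oy ry _ _ _]; rewrite PhiE// (f_fin SA). Qed.

Lemma rate_boundE N u : phi u \is a fin_num ->
  rate_bound phi st N u =
  (2 * rbregman phi u (it_z (st 0%N)) / step_sum N ^+ 2)%:E.
Proof.
move=> pu; have /run_admissible[_ _ _ z_int _] : completed len 0 by case: len.
by rewrite /rate_bound (bregmanE pu (phi_fin phiL z_int)).
Qed.

Lemma run_rate_bound N u : (0 < N)%N -> completed len N ->
  dom (Phi f rho) u -> dom phi u ->
  (Phi f rho (it_y (st N)) - Phi f rho u <= rate_bound phi st N u)%E.
Proof.
move=> N0 Nc /dom_Phi[fu ru] pu; have [[phi_ninf _] _ _ _ _] := phiL.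
have {}pu := dom_fin phi_ninf pu.
by rewrite Phi_iterate// PhiE// rate_boundE// -EFinB lee_fin run_rate.
Qed.

Section Minimizer.
Variable xs : 'rV[R]_n.
Hypothesis xs_min : is_minimizer psi f rho xs.

Lemma minimizer_Phi_star : Phi_star psi f rho = Phi f rho xs.
Proof.
case: xs_min => xs_cl xs_le; apply/le_anti/andP; split.
  by apply: ereal_inf_lbound; exists xs.
by apply: le_ereal_inf_tmp => _ [x x_cl <-]; exact: xs_le.
Qed.

Lemma minimizer_dom_Phi : dom (Phi f rho) xs.
Proof.
have c0 : completed len 0 by case: len.
have [Oy _ _ _ _] := run_admissible c0.
case: xs_min => _ /(_ _ (subset_closure Oy)) /le_lt_trans; apply.
by rewrite Phi_iterate// ltry.
Qed.

Lemma minimizer_le k : completed len k ->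
  rPhi f rho xs <= rPhi f rho (it_y (st k)).
Proof.
move=> kc; have [fx rx] := dom_Phi minimizer_dom_Phi.
have [Oy _ _ _ _] := run_admissible kc.
rewrite -lee_fin -PhiE// -Phi_iterate//.
by case: xs_min => _ /(_ _ (subset_closure Oy)).
Qed.

Lemma run_bigO (c : R) : dom phi xs -> 0 < c ->
  (forall k, (0 < k)%N -> completed len k ->
     c <= it_lam (st k) / it_kap (st k)) ->
  bigO_inv_sq len
    (fun N => Phi f rho (it_y (st N)) - Phi_star psi f rho)%E.
Proof.
move=> pxs c0 cle; have [fx rx] := dom_Phi minimizer_dom_Phi.
have [[phi_ninf _] _ _ _ _] := phiL.
have {}pxs := dom_fin phi_ninf pxs.
exists (2 * rbregman phi xs (it_z (st 0%N)) / c) => k k0 kc.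
rewrite minimizer_Phi_star Phi_iterate// PhiE// -EFinB abse_EFin lee_fin.
rewrite ger0_norm ?subr_ge0 ?minimizer_le//.
apply: le_trans (run_rate k0 kc fx rx pxs) _.
rewrite -[leRHS]mulrA -invfM.
have D0 := z0_bregman_ge0 pxs.
apply: ler_wpM2l; first by rewrite mulr_ge0.
have kR : 0 < (k%:R : R) by rewrite ltr0n.
rewrite lef_pV2 ?posrE ?exprn_gt0 ?step_sum_gt0//; last first.
  by rewrite mulr_gt0// exprn_gt0.
have := step_sum_ge (ltW c0) kc cle.
rewrite -(@ler_pXn2r _ 2%N)// ?nnegrE ?mulr_ge0 ?sqrtr_ge0 ?ler0n//.
  by rewrite exprMn sqr_sqrtr ?(ltW c0)// mulrC.
by rewrite ltW// step_sum_gt0.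
Qed.

End Minimizer.

End Runs.

(** * Burg and entropy functions *)

Section ScalarInequalities.
Context {R : realType}.
Implicit Types (a b r t A e K : R).

Lemma ln_le_sub1 t : 0 < t -> ln t <= t - 1.
Proof.
move=> t0; have := @le_ln1Dx R (t - 1); rewrite [1 + _]addrC subrK; apply; lra.
Qed.

Lemma sub1_ln_ge0 t : 0 < t -> 0 <= t - 1 - ln t.
Proof. by move=> /ln_le_sub1; lra. Qed.

(** Apply [ln t <= t - 1] at the square root of [r]. *)
Lemma sqr_le_sub1_ln r K : 0 < r <= K ->
  (r - 1) ^+ 2 <= 2 * (K + 1) * (r - 1 - ln r).
Proof.
move=> /andP[r0 rK]; pose q := Num.sqrt r.
have q0 : 0 < q by rewrite sqrtr_gt0.
have rE : r = q ^+ 2 by rewrite sqr_sqrtr// ltW.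
have lnE : ln r = 2 * ln q by rewrite rE expr2 lnM ?posrE//; ring.
have lq := ln_le_sub1 q0; have l1 : (q - 1) ^+ 2 <= r - 1 - ln r.
  by rewrite lnE rE; lra.
have s0 := sqr_ge0 (q - 1).
have h : (q + 1) ^+ 2 <= 2 * (K + 1) by rewrite rE in rK; lra.
have -> : (r - 1) ^+ 2 = (q + 1) ^+ 2 * (q - 1) ^+ 2 by rewrite rE; ring.
apply: ler_pM => //; exact: sqr_ge0.
Qed.

(** The lower bound drops [r]; the upper one splits [ln r] as
    [ln (r / 2) + ln 2]. *)
Lemma sub1_ln_bounds r e : 0 < r -> r - 1 - ln r <= e ->
  expR (- (e + 1)) <= r <= 2 * (e + 1).
Proof.
move=> r0 re; apply/andP; split.
  by rewrite -[leRHS](lnK r0) ler_expR; lra.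
have h1 : ln (r / 2) <= r / 2 - 1 by apply: ln_le_sub1; lra.
have h2 : ln 2 <= 1 :> R by apply: le_trans (ln_le_sub1 _) _; lra.
have lnE : ln r = ln (r / 2) + ln 2.
  by rewrite -lnM ?posrE ?divr_gt0// divfK.
by rewrite lnE in re; lra.
Qed.

(** Both signs of [a] follow from [expR (- a) - 1 + a <= a (1 - expR (- a))]. *)
Lemma expRN_quadratic a A : 0 <= A -> - A <= a ->
  expR (- a) - 1 + a <= expR A * a ^+ 2.
Proof.
move=> A0 aA; set E := expR (- a).
have E0 : 0 < E by exact: expR_gt0.
have lE : 1 - a <= E by have := expR_ge1Dx (- a); rewrite -/E; lra.
have EA : E <= expR A by rewrite ler_expR; lra.
have A1 : 1 <= expR A by have := expR_ge1Dx A; lra.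
have uE : E * (1 + a) <= 1.
  have := expR_ge1Dx a; rewrite -(ler_pM2l E0) /E -expRD addNr expR0.
  by [].
have [a0|a0] := lerP 0 a; first by nra.
have : 0 <= (expR A - E) * a ^+ 2 by rewrite mulr_ge0 ?sqr_ge0// subr_ge0.
nra.
Qed.

End ScalarInequalities.

Section BurgEntropy.
Context {R : realType} {n : nat}.
Implicit Types (x y z u v p yh : 'rV[R]_n).

Definition positive x := forall j, 0 < x ord0 j.

Lemma burgE x : positive x -> burg x = (- \sum_(j < n) ln (x ord0 j))%:E.
Proof. by rewrite /burg => xp; case: ifPn => // /forallP[]. Qed.

Lemma dom_burg x : dom burg x -> positive x.
Proof. by rewrite /dom /burg /=; case: ifPn => // /forallP. Qed.

Lemma Omega_burg x : Omega burg x <-> positive x.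
Proof.
split=> [/interior_subset/dom_burg//|xp]; rewrite /Omega /interior /=.
have : nbhs x [set y : 'rV[R]_n | forall j, 0 < y ord0 j].
  apply: (@filter_forall _ _ (fun j => [set y : 'rV[R]_n | 0 < y ord0 j]) (nbhs x)) => j.
  exact: (cvgr_gt _ (@coord_continuous R 1 n ord0 j x) 0 (xp j)).
by apply: filterS => y yp; rewrite /dom /= burgE// ltry.
Qed.

(** The candidate is a subgradient, by [ln t <= t - 1] in each coordinate, so no
    derivative has to be computed; [grad_entropy] is obtained in the same way. *)
Lemma grad_burg x : ediff (@burg R n) x -> positive x ->
  grad burg x = \row_j - (x ord0 j)^-1.
Proof.
move=> dx xp; apply: subgrad_grad => // y yf.
have yp : positive y.
  by apply: dom_burg; move: yf; rewrite fin_numE /dom /= ltey => /andP[].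
rewrite !burgE//= /dot -!sumrN -big_split /=; apply: ler_sum => j _.
rewrite !mxE; have := ln_le_sub1 (divr_gt0 (yp j) (xp j)).
rewrite ln_div ?posrE//.
have -> : - (x ord0 j)^-1 * (y ord0 j - x ord0 j) = 1 - y ord0 j / x ord0 j.
  by field; rewrite gt_eqF.
lra.
Qed.

Lemma burg_bregman u v : ediff (@burg R n) v -> positive u -> positive v ->
  rbregman burg u v =
  \sum_(j < n) (u ord0 j / v ord0 j - 1 - ln (u ord0 j / v ord0 j)).
Proof.
move=> dv up vp; rewrite /rbregman grad_burg// !burgE//= /dot -!sumrN -!big_split /=.
apply: eq_bigr => j _; rewrite !mxE ln_div ?posrE//; field.
by rewrite gt_eqF.
Qed.

Lemma entropyE x : (forall j, 0 <= x ord0 j) ->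
  entropy x = (\sum_(j < n) (x ord0 j * ln (x ord0 j) - x ord0 j))%:E.
Proof. by rewrite /entropy => xp; case: ifPn => // /forallP[]. Qed.

Lemma dom_entropy x : dom entropy x -> forall j, 0 <= x ord0 j.
Proof. by rewrite /dom /entropy /=; case: ifPn => // /forallP. Qed.

(** The domain contains boundary points of the orthant, but from such a point it
    can be left in a coordinate direction. *)
Lemma interior_dom_entropy z : (dom entropy)° z -> positive z.
Proof.
move=> zint j.
have : \forall t \near 0^'+, 0 < t /\ dom entropy (z + t *: - delta_mx ord0 j).
  near=> t; split; first by near: t; exact: nbhs_right_gt.
  by near: t; apply: (near_ray (P := dom entropy)).
move=> /filter_ex[t [t0 /dom_entropy/(_ j)]].
by rewrite !mxE !eqxx /=; lra.
Unshelve. all: by end_near. Qed.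

Lemma entropy_tangent (a b : R) : 0 <= a -> 0 < b ->
  b * ln b - b + ln b * (a - b) <= a * ln a - a.
Proof.
rewrite le_eqVlt => /predU1P[<-|a0] b0; first by rewrite mul0r; nra.
have := ln_le_sub1 (divr_gt0 b0 a0); rewrite ln_div ?posrE//.
rewrite -(ler_pM2l a0) mulrBr [a * (_ - 1)]mulrBr mulrCA mulfV ?gt_eqF//; lra.
Qed.

Lemma grad_entropy z : ediff (@entropy R n) z -> positive z ->
  grad entropy z = \row_j ln (z ord0 j).
Proof.
move=> dz zp; have zp' j : 0 <= z ord0 j by exact: ltW.
apply: subgrad_grad => // y yf.
have yp : forall j, 0 <= y ord0 j.
  by apply: dom_entropy; move: yf; rewrite fin_numE /dom /= ltey => /andP[].
rewrite !entropyE//= /dot -big_split /=; apply: ler_sum => j _.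
by rewrite !mxE; exact: entropy_tangent.
Qed.

Lemma entropy_bregman u v : ediff (@entropy R n) v -> positive u ->
  positive v ->
  rbregman entropy u v =
  \sum_(j < n) u ord0 j * (v ord0 j / u ord0 j - 1 - ln (v ord0 j / u ord0 j)).
Proof.
move=> dv up vp; rewrite /rbregman grad_entropy// !entropyE; last 2 first.
- by move=> j; exact: ltW.
- by move=> j; exact: ltW.
rewrite /= /dot -!sumrN -!big_split /=.
apply: eq_bigr => j _; rewrite !mxE ln_div ?posrE//; field.
by rewrite gt_eqF.
Qed.

(** The conjugate is at most [sum_j expR (p_j)] everywhere. *)
Lemma conjugate_entropy_interior p : (dom (conjugate (@entropy R n)))° p.
Proof.
rewrite /interior /=; apply: filterE => {}p; rewrite /dom /=.
apply: le_lt_trans (ltry (\sum_(j < n) expR (p ord0 j))).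
apply: ge_ereal_sup => _ [x _ <-].
have [xf|] := boolP (entropy x \is a fin_num); last first.
  rewrite fin_numE negb_and !negbK => /orP[/eqP|/eqP->]; last by rewrite leNye.
  by rewrite /entropy; case: ifP.
have xp : forall j, 0 <= x ord0 j.
  by apply: dom_entropy; move: xf; rewrite fin_numE /dom /= ltey => /andP[].
rewrite entropyE// -EFinB lee_fin /dot -sumrN -big_split /=; apply: ler_sum => j _.
have := expR_ge1Dx (p ord0 j - ln (x ord0 j)).
have := xp j; rewrite le_eqVlt => /predU1P[<- _|x0].
  by rewrite !mul0r !subr0 expR_ge0.
rewrite expRD expRN lnK ?posrE// -(ler_pM2l x0) mulrCA mulfV ?gt_eqF//; lra.
Qed.

End BurgEntropy.

(** * The Burg divergence under convex combinations *)

Section BurgDivergence.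
Context {R : realType} {n : nat}.
Implicit Types (u v x y z : 'rV[R]_n).

(** [D_psi(u, v)] for the Burg function. *)
Definition burg_div u v : R :=
  \sum_(j < n) (u ord0 j / v ord0 j - 1 - ln (u ord0 j / v ord0 j)).

Lemma burg_div_coord u v (C : R) : positive u -> positive v ->
  burg_div u v <= C ->
  forall j, u ord0 j / v ord0 j - 1 - ln (u ord0 j / v ord0 j) <= C.
Proof.
move=> up vp uvC j; apply: le_trans uvC; rewrite /burg_div (bigD1 j)//= lerDl.
by apply: sumr_ge0 => i _; rewrite sub1_ln_ge0// divr_gt0.
Qed.

Lemma burg_div_ge0 u v : positive u -> positive v -> 0 <= burg_div u v.
Proof.
by move=> up vp; apply: sumr_ge0 => i _; rewrite sub1_ln_ge0// divr_gt0.
Qed.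

(** The summands are nonnegative, so each ratio [u_j / v_j] is confined. *)
Lemma burg_div_bounds u v (a M C : R) : 0 < a ->
  (forall j, a <= u ord0 j <= M) -> positive v -> burg_div u v <= C ->
  forall j, a / (2 * (C + 1)) <= v ord0 j <= M * expR (C + 1).
Proof.
move=> a0 uaM vp uvC j.
have up : positive u by move=> i; apply: lt_le_trans a0 _; case/andP: (uaM i).
have C0 : 0 <= C by exact: le_trans (burg_div_ge0 up vp) uvC.
have r0 : 0 < u ord0 j / v ord0 j by rewrite divr_gt0.
have /andP[] := sub1_ln_bounds r0 (burg_div_coord up vp uvC j).
have v0 := vp j; have /andP[au uM] := uaM j.
rewrite ler_pdivlMr// ler_pdivrMr// expRN => h1 h2; apply/andP; split.
  by rewrite ler_pdivrMr; [lra | rewrite mulr_gt0//; lra].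
rewrite -ler_pdivrMr ?expR_gt0// mulrC; exact: le_trans h1 uM.
Qed.

(** Moving [y] towards a point [z] of a box keeps [burg_div u] below a fixed
    level or does not increase it.  If the coordinates of [x] are not all
    bounded below, then the move is short and some coordinate of [y] is small;
    that coordinate lowers the divergence at rate at least
    [(a / 2) / y_j], which outweighs the bounded rates of the coordinates that
    are not small. *)
Lemma burg_div_mix u (a M : R) : 0 < a -> (forall j, a <= u ord0 j <= M) ->
  exists C, forall y z t,
    (forall j, 0 < y ord0 j <= M) -> (forall j, a <= z ord0 j <= M) ->
    0 < t <= 1 ->
    burg_div u (y + t *: (z - y)) <= Num.max (burg_div u y) C.
Proof.
move=> a0 uaM.
have up : positive u by move=> j; apply: lt_le_trans a0 _; case/andP: (uaM j).
pose d0 := a / 4; pose N : R := n%:R + 1; pose M1 := `|M| + a.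
have M10 : 0 < M1 by rewrite /M1; have := normr_ge0 M; lra.
have MM1 : M <= M1 by rewrite /M1; have := ler_norm M; lra.
have aM1 : a <= M1 by rewrite /M1; have := normr_ge0 M; lra.
have d00 : 0 < d0 by rewrite /d0; lra.
(* [C1] bounds the rate of a coordinate with [y_j >= d0]; a coordinate below [d1]
   outweighs [n] of them.  Moves of length [t >= t0] leave every coordinate above
   [t0 * a]. *)
pose C1 := (M1 / d0) * (1 + M1 / d0).
have q0 : 0 < M1 / d0 by rewrite divr_gt0.
have C10 : 0 < C1 by rewrite mulr_gt0// addr_gt0.
have N0 : 0 < N by rewrite /N; have := ler0n R n; lra.
pose d1 := Num.min d0 ((a / 2) / (N * C1)).
have a20 : 0 < a / 2 by lra.
have NC0 : 0 < N * C1 by rewrite mulr_gt0.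
have d10 : 0 < d1 by rewrite lt_min d00 divr_gt0.
pose t0 := a / (4 * M1).
have t00 : 0 < t0 by rewrite divr_gt0// mulr_gt0.
pose d2 := Num.min d1 (t0 * a).
have d20 : 0 < d2 by rewrite lt_min d10 mulr_gt0.
have d2d1 : d2 <= d1 by rewrite ge_min lexx.
have d1d0 : d1 <= d0 by rewrite ge_min lexx.
exists (\sum_(j < n) (M1 / d2 + M1 / a)) => y z t ybd zbd /andP[tp t1].
set x := y + _; have xE j : x ord0 j = y ord0 j + t * (z ord0 j - y ord0 j).
  by rewrite !mxE.
have xp j : 0 < x ord0 j.
  by rewrite xE; have /andP[? ?] := ybd j; have /andP[? ?] := zbd j; nra.
have xM j : x ord0 j <= M1.
  rewrite xE; have /andP[? ?] := ybd j; have /andP[? ?] := zbd j.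
  apply: le_trans MM1.
  have : 0 <= (1 - t) * (M - y ord0 j) by rewrite mulr_ge0 ?subr_ge0.
  have : 0 <= t * (M - z ord0 j) by rewrite mulr_ge0 ?subr_ge0 ?(ltW tp).
  by lra.
have [/forallP big|/forallPn[i]] := boolP [forall j, d2 <= x ord0 j].
  rewrite le_max; apply/orP; right; apply: ler_sum => j _.
  have /andP[uj uM] := uaM j; have xj := big j.
  have h1 : u ord0 j / x ord0 j <= M1 / d2.
    by apply: ler_pM; rewrite ?invr_ge0 ?(ltW (up j)) ?(ltW (xp j))//;
      [exact: le_trans uM MM1 | rewrite lef_pV2 ?posrE].
  have h2 := ln_le_sub1 (divr_gt0 (xp j) (up j)).
  have h3 : x ord0 j / u ord0 j <= M1 / a.
    by apply: ler_pM; rewrite ?invr_ge0 ?(ltW (up j)) ?(ltW (xp j))//;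
      rewrite lef_pV2 ?posrE.
  have : ln (u ord0 j / x ord0 j) = - ln (x ord0 j / u ord0 j).
    by rewrite !ln_div ?posrE//; ring.
  lra.
rewrite -ltNge lt_min => /andP[xi1 xi2].
rewrite le_max; apply/orP; left.
have tt0 : t < t0.
  rewrite -(ltr_pM2r a0); apply: le_lt_trans xi2; rewrite xE.
  by have /andP[? ?] := ybd i; have /andP[? ?] := zbd i; nra.
have tM1 : t * M1 <= d0.
  have -> : d0 = t0 * M1 by rewrite /t0 /d0; field; rewrite gt_eqF.
  by rewrite ler_pM2r// ltW.
have yi : y ord0 i < d1.
  rewrite ltNge; apply/negP => d1y; move: xi1; apply/negP; rewrite -leNgt xE.
  have /andP[? ?] := zbd i; have : d1 <= z ord0 i by apply: le_trans d1d0 _; rewrite /d0; lra.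
  by nra.
(* [T j] is the contribution of coordinate [j] to the variation of the
   divergence, and [ln t <= t - 1] at [x_j / y_j] gives [T_le]. *)
pose T j := u ord0 j / x ord0 j - 1 - ln (u ord0 j / x ord0 j)
           - (u ord0 j / y ord0 j - 1 - ln (u ord0 j / y ord0 j)).
have T_le j : T j <= t * ((z ord0 j - y ord0 j) / y ord0 j)
                     * (1 - u ord0 j / x ord0 j).
  have /andP[yp _] := ybd j; have := ln_le_sub1 (divr_gt0 (xp j) yp).
  have -> : ln (x ord0 j / y ord0 j) =
      ln (u ord0 j / y ord0 j) - ln (u ord0 j / x ord0 j).
    by rewrite !ln_div ?posrE//; ring.
  have -> : x ord0 j / y ord0 j - 1 = t * ((z ord0 j - y ord0 j) / y ord0 j).
    by rewrite xE; field; rewrite gt_eqF.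
  have -> : t * ((z ord0 j - y ord0 j) / y ord0 j) * (1 - u ord0 j / x ord0 j) =
     t * ((z ord0 j - y ord0 j) / y ord0 j)
     + (u ord0 j / x ord0 j - u ord0 j / y ord0 j).
    have := xE j; move: (x ord0 j) (xp j) => w w0 wE.
    have -> : t * ((z ord0 j - y ord0 j) / y ord0 j) = (w - y ord0 j) / y ord0 j.
      by rewrite wE; field; rewrite gt_eqF.
    by field; rewrite !gt_eqF.
  by rewrite /T; lra.
have T_small j : y ord0 j < d0 -> T j <= - (t * ((a / 2) / y ord0 j)).
  move=> yd; apply: le_trans (T_le j) _.
  have /andP[yp _] := ybd j; have /andP[za zM] := zbd j; have /andP[ua _] := uaM j.
  have ux : 2 <= u ord0 j / x ord0 j.
    rewrite ler_pdivlMr// xE; have : t * z ord0 j <= t * M1.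
      by rewrite ler_pM2l//; exact: le_trans zM MM1.
    by move: tM1 yd; rewrite /d0; nra.
  rewrite -mulrA -[leRHS]mulrN ler_pM2l// -[leRHS]mulNr mulrAC ler_pM2r ?invr_gt0//.
  by move: yd; rewrite /d0; nra.
have T_all j : T j <= t * C1.
  have /andP[yp yM] := ybd j; have /andP[za zM] := zbd j; have /andP[ua uM] := uaM j.
  have [yd|yd] := ltP (y ord0 j) d0.
    apply: le_trans (T_small j yd) _; apply: le_trans (_ : 0 <= _).
      by rewrite oppr_le0; apply: mulr_ge0; [|apply: divr_ge0]; exact: ltW.
    by rewrite mulr_ge0 ?(ltW tp) ?(ltW C10).
  apply: le_trans (T_le j) _; rewrite -mulrA ler_pM2l//.
  have xd : d0 <= x ord0 j.
    have dz : d0 <= z ord0 j by rewrite /d0; lra.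
    have : 0 <= (1 - t) * (y ord0 j - d0) by rewrite mulr_ge0 ?subr_ge0.
    have : 0 <= t * (z ord0 j - d0) by rewrite mulr_ge0 ?subr_ge0 ?(ltW tp).
    by rewrite xE; lra.
  apply: le_trans (ler_norm _) _; rewrite normrM; apply: ler_pM => //.
    rewrite normrM normfV (gtr0_norm yp); apply: ler_pM => //.
    - by rewrite invr_ge0 ltW.
    - by rewrite ler_norml; apply/andP; split; lra.
    - by rewrite lef_pV2 ?posrE.
  apply: le_trans (ler_normB _ _) _; rewrite normr1 lerD2l ger0_norm; last first.
    by rewrite divr_ge0 ?(ltW (up j)) ?(ltW (xp j)).
  apply: ler_pM; rewrite ?invr_ge0 ?(ltW (up j)) ?(ltW (xp j))//.
    exact: le_trans uM MM1.
  by rewrite lef_pV2 ?posrE.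
suff : \sum_(j < n) T j <= 0 by rewrite /T sumrB subr_le0.
rewrite (bigD1 i)//=.
have /andP[yi0 _] := ybd i.
have Ti : T i <= - (t * (N * C1)).
  apply: le_trans (T_small i (lt_le_trans yi d1d0)) _.
  rewrite lerN2 ler_pM2l// ler_pdivlMr//.
  have := ltW yi; rewrite le_min => /andP[_].
  by rewrite ler_pdivlMr// mulrC.
have Trest : \sum_(j < n | j != i) T j <= \sum_(j < n) t * C1.
  rewrite [leRHS](bigD1 i)//= -[leLHS]add0r lerD//; first by rewrite mulr_ge0 ?(ltW tp) ?(ltW C10).
  by apply: ler_sum => j _; exact: T_all.
move: Trest; rewrite sumr_const card_ord -mulr_natl.
have : 0 <= t * C1 by rewrite mulr_ge0 ?(ltW tp) ?(ltW C10).
by move: Ti; rewrite /N; nra.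
Qed.

End BurgDivergence.

(** * Bounded step parameters in the Burg-entropy geometry *)

Section BurgEntropyRuns.
Context {R : realType} {n : nat}.
Variables (f rho : 'rV[R]_n -> \bar R) (y0 : 'rV[R]_n).
Variables (lam0 kap0 gam_p gam_m gam_k : R).
Variables (len : option nat) (st : nat -> iterate R n).
Hypothesis SA : standing_assumptions burg f rho.
Hypothesis f_cvx : convex_efun f.
Hypothesis inputs : ga_inputs burg rho entropy y0 lam0 kap0 gam_p gam_m gam_k.
Hypothesis run :
  ga_run burg f rho entropy gam_p gam_m gam_k y0 lam0 kap0 len st.
Hypothesis bounded : forall r : R, bounded_set
  (closure (Omega burg) `&` [set x | (Phi f rho x <= r%:E)%E]).
Variable xs : 'rV[R]_n.
Hypothesis xs_min : is_minimizer burg f rho xs.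
Hypothesis xs_Omega : Omega burg xs.
Implicit Types (u x y z yh : 'rV[R]_n) (lam kap : R).

Let phiL := phi_Legendre inputs.
Let gp1 := gam_p_ge1 inputs.
Let gm1 := gam_m_gt1 inputs.
Let gk1 := gam_k_gt1 inputs.

Let c0 : completed len 0. Proof. by case: len. Qed.

Let xs_pos : positive xs. Proof. exact/Omega_burg. Qed.

Let xs_fin : f xs \is a fin_num /\ rho xs \is a fin_num.
Proof. exact: (dom_Phi SA (minimizer_dom_Phi SA inputs run xs_min)). Qed.

Let adm k : completed len k -> admissible burg rho entropy (st k).
Proof. exact: run_admissible SA inputs run _. Qed.

Lemma positive_box x : positive x ->
  exists a M, 0 < a /\ forall j, a <= x ord0 j <= M.
Proof.
move=> xp; pose S := \sum_(j < n) (x ord0 j)^-1.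
have S0 : 0 <= S by apply: sumr_ge0 => j _; rewrite invr_ge0 ltW.
exists (1 + S)^-1, (\sum_(j < n) x ord0 j); split=> [|j].
  by rewrite invr_gt0; lra.
apply/andP; split.
  rewrite -[leRHS]invrK lef_pV2 ?posrE ?invr_gt0//; last by lra.
  have : (x ord0 j)^-1 <= S.
    rewrite /S (bigD1 j)//= lerDl; apply: sumr_ge0 => i _.
    by rewrite invr_ge0 ltW.
  by lra.
by rewrite (bigD1 j)//= lerDl; apply: sumr_ge0 => i _; exact: ltW.
Qed.

Lemma coord_le_norm x j : `|x ord0 j| <= `|x|.
Proof.
rewrite [leRHS]/Num.Def.normr /= mx_normrE; apply/bigmax_geP; right => /=.
by exists (ord0, j).
Qed.

Let E0 : R := rbregman entropy xs (it_z (st 0%N)).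

Let E0_ge0 : 0 <= E0.
Proof.
apply: (z0_bregman_ge0 SA inputs run).
by rewrite entropyE// => j; exact: ltW.
Qed.

(* The two nonnegative parts of the Lyapunov function at [xs] are bounded
   separately by its initial value [E0]. *)
Let gap k : R := it_omega (st k) * (rPhi f rho (it_y (st k)) - rPhi f rho xs).

Let gap_ge0 k : completed len k -> 0 <= gap k.
Proof.
move=> kc; have [_ _ _ _ [w0 _ _]] := adm kc.
by rewrite mulr_ge0// subr_ge0 (minimizer_le SA inputs run xs_min).
Qed.

Let z_pos k : completed len k -> positive (it_z (st k)).
Proof. by move=> /adm[_ _ _ /interior_dom_entropy]. Qed.

Let zdiff k : completed len k -> ediff entropy (it_z (st k)).
Proof. by move=> /adm[_ _ _ /(phi_diff phiL)]. Qed.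

Let energy k : completed len k ->
  gap k + rbregman entropy xs (it_z (st k)) <= E0.
Proof.
by move=> kc; have [fx rx] := xs_fin; exact: (run_lyapunov SA f_cvx inputs run).
Qed.

Let gap_le k : completed len k -> gap k <= E0.
Proof.
move=> kc; apply: le_trans (energy kc); rewrite lerDl.
rewrite entropy_bregman//; [|exact: zdiff|exact: z_pos].
apply: sumr_ge0 => j _; rewrite mulr_ge0 ?(ltW (xs_pos j))// sub1_ln_ge0//.
by rewrite divr_gt0//; exact: z_pos.
Qed.

(** The Lyapunov inequality bounds [D_phi xs], whose sublevel sets are compact
    in the open orthant because [xs] is interior. *)
Lemma mirror_points_box : exists a M, 0 < a /\ forall k, completed len k ->
  forall j, a <= it_z (st k) ord0 j <= M.
Proof.
have [b [B [b0 xsb]]] := positive_box xs_pos.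
pose e := E0 / b + 1.
exists (b * expR (- e)), (B * (2 * e)); split=> [|k kc j].
  by rewrite mulr_gt0// expR_gt0.
have zp := z_pos kc.
have := energy kc; rewrite entropy_bregman//; last exact: zdiff.
have := gap_ge0 kc; move=> g0 En.
have u0 := xs_pos j; have /andP[bu uB] := xsb j.
pose r := it_z (st k) ord0 j / xs ord0 j.
have r0 : 0 < r by rewrite divr_gt0.
have X0 : 0 <= r - 1 - ln r by exact: sub1_ln_ge0.
have uX : xs ord0 j * (r - 1 - ln r) <= E0.
  rewrite (bigD1 j)//= -/r in En.
  have : 0 <= \sum_(i < n | i != j) xs ord0 i * (it_z (st k) ord0 i / xs ord0 i
      - 1 - ln (it_z (st k) ord0 i / xs ord0 i)).
    apply: sumr_ge0 => i _; rewrite mulr_ge0 ?(ltW (xs_pos i))//.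
    by rewrite sub1_ln_ge0// divr_gt0.
  by lra.
have Xe : r - 1 - ln r <= E0 / b.
  by rewrite ler_pdivlMr// mulrC; apply: le_trans uX; rewrite ler_wpM2r.
have /andP[r1 r2] := sub1_ln_bounds r0 Xe; rewrite -/e in r1 r2.
have -> : it_z (st k) ord0 j = xs ord0 j * r by rewrite /r mulrC divfK ?gt_eqF.
have b0' := ltW b0; have e1 : 0 <= expR (- e) by exact: expR_ge0.
by apply/andP; split; apply: ler_pM => //; exact: ltW.
Qed.

(** Since [omega_k >= omega_1] for [k >= 1], the Lyapunov inequality keeps the
    iterates in one sublevel set of [Phi]. *)
Lemma primal_points_le : exists M, forall k, completed len k ->
  forall j, it_y (st k) ord0 j <= M.
Proof.
pose r := Num.max (rPhi f rho (it_y (st 0%N)))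
                  (rPhi f rho xs + E0 / it_omega (st 1%N)).
have [M [_ MA]] := bounded r.
exists (M + 1) => k kc j.
apply: le_trans (ler_norm _) _; apply: le_trans (coord_le_norm _ _) _.
apply: MA; first by rewrite ltrDl.
have [Oy _ _ _ _] := adm kc; split; first exact: subset_closure.
rewrite /= (Phi_iterate SA inputs run kc) lee_fin le_max.
case: k kc {Oy} => [|k] kc; first by rewrite lexx.
apply/orP; right.
have c1 : completed len 1.
  by elim: k kc => // k IH /completed_pred.
have w1 : 0 < it_omega (st 1%N) by exact: (run_omega_gt0 SA inputs run).
have wk : it_omega (st 1%N) <= it_omega (st k.+1).
  elim: k kc => // k IH kc; apply: le_trans (IH (completed_pred kc)) _.
  have [_ [[tr _ _ _ _] [_ ->]]] := run_step run kc.
  have [l0 k0] := tried_gt0 gp1 gm1 gk1 (adm (completed_pred kc)) tr.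
  by rewrite lerDl ltW// trial_alpha_gt0.
rewrite -lerBlDl ler_pdivlMr//.
apply: le_trans (gap_le kc); rewrite /gap mulrC.
rewrite ler_wpM2r// subr_ge0; exact: (minimizer_le SA inputs run xs_min).
Qed.

Let burg_divE u v : Omega burg u -> Omega burg v ->
  rbregman burg u v = burg_div u v.
Proof.
move=> Ou Ov; apply: burg_bregman; first exact: (psi_diff SA Ov).
  exact/Omega_burg.
exact/Omega_burg.
Qed.

(** By Fejer monotonicity and [burg_div_mix], [burg_div xs] never exceeds a
    fixed level at the iterates or at the trial points. *)
Lemma trial_points_box : exists b B, [/\ 0 < b,
  forall j, b <= xs ord0 j <= B,
  forall k, completed len k -> forall j, b <= it_z (st k) ord0 j <= B &
  forall k lam kap yh, completed len k -> 0 < lam -> 0 < kap ->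
    trial_point burg f rho (st k) lam kap yh ->
    smooth_test burg f (st k) lam kap yh ->
    forall j, b <= trial_x (st k) lam kap ord0 j <= B /\ b <= yh ord0 j <= B].
Proof.
have [a1 [M1 [a10 xsb]]] := positive_box xs_pos.
have [a2 [M2 [a20 zb]]] := mirror_points_box.
have [M3 yM3] := primal_points_le.
pose a := Num.min a1 a2; pose M := Num.max M1 (Num.max M2 M3).
have a0 : 0 < a by rewrite lt_min a10.
have xsb' j : a <= xs ord0 j <= M.
  by have /andP[? ?] := xsb j; rewrite ge_min le_max; apply/andP; split; apply/orP; left.
have zb' k : completed len k -> forall j, a <= it_z (st k) ord0 j <= M.
  move=> kc j; have /andP[za zM] := zb k kc j.
  by rewrite ge_min !le_max za zM !orbT.
have [C0 mix] := burg_div_mix a0 xsb'.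
pose C := Num.max (burg_div xs (it_y (st 0%N))) C0.
have mixC k lam kap : completed len k -> 0 < lam -> 0 < kap ->
    burg_div xs (it_y (st k)) <= C ->
    burg_div xs (trial_x (st k) lam kap) <= C.
  move=> kc l0 k0 yC; rewrite (trial_xE (adm kc) l0 k0).
  apply: le_trans (mix _ _ _ _ _ _) _.
  - move=> j; have [/Omega_burg yp _ _ _ _] := adm kc.
    by rewrite yp !le_max yM3// !orbT.
  - exact: zb'.
  - exact: trial_tau (adm kc) l0 k0.
  - by rewrite ge_max yC /C le_max lexx orbT.
have fejC k lam kap yh : completed len k -> 0 < lam -> 0 < kap ->
    burg_div xs (it_y (st k)) <= C ->
    trial_point burg f rho (st k) lam kap yh ->
    smooth_test burg f (st k) lam kap yh ->
    burg_div xs yh <= C.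
  move=> kc l0 k0 yC tp sm; have [fx rx] := xs_fin.
  have Ox := trial_x_Omega SA (adm kc) l0 k0.
  have Oyh := trial_yh_Omega SA (adm kc) l0 k0 tp.
  apply: le_trans (mixC k lam kap kc l0 k0 yC).
  rewrite -!burg_divE//.
  apply: (trial_fejer SA f_cvx (adm kc) l0 k0 tp sm fx rx).
  have ryh := trial_yh_rho SA (adm kc) l0 k0 tp.
  rewrite -lee_fin -!PhiE//; last exact: (f_fin SA Oyh).
  by case: xs_min => _ /(_ _ (subset_closure Oyh)).
have yC k : completed len k -> burg_div xs (it_y (st k)) <= C.
  elim: k => [_|k IH kc]; first by rewrite /C le_max lexx.
  have kc' := completed_pred kc.
  have [_ [[tr tp sm _ _] _]] := run_step run kc.
  have [l0 k0] := tried_gt0 gp1 gm1 gk1 (adm kc') tr.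
  exact: (fejC _ _ _ _ kc' l0 k0 (IH kc') tp sm).
have C_ge0 : 0 <= C.
  have [/Omega_burg y0p _ _ _ _] := adm c0.
  by rewrite /C le_max burg_div_ge0.
pose b := Num.min a (a / (2 * (C + 1))).
pose B := Num.max M (M * expR (C + 1)).
have wide v : Omega burg v -> burg_div xs v <= C ->
    forall j, b <= v ord0 j <= B.
  move=> /Omega_burg vp vC j.
  have /andP[h1 h2] := burg_div_bounds a0 xsb' vp vC j.
  by rewrite ge_min le_max h1 h2 !orbT.
have wide' w : a <= w <= M -> b <= w <= B.
  by move=> /andP[h1 h2]; rewrite ge_min le_max h1 h2.
exists b, B; split.
- by rewrite lt_min a0 divr_gt0// mulr_gt0//; lra.
- by move=> j; exact: wide'.
- by move=> k kc j; apply: wide'; exact: zb'.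
move=> k lam kap yh kc l0 k0 tp sm j; split.
  apply: wide; first exact: (trial_x_Omega SA (adm kc) l0 k0).
  by apply: mixC => //; exact: yC.
apply: wide; first exact: (trial_yh_Omega SA (adm kc) l0 k0 tp).
by apply: (fejC k lam kap) => //; exact: yC.
Qed.

(** For the step [a = alpha *: g], both sides of the mirror test are comparable to
    the square norm of [a]: on the box the left side is at most
    [B * expR A * dot a a] once [|a_j| <= A], and the right side at least
    [kap * c * dot a a].  The bound [A] comes from the trial estimate at [xs],
    which reads [kap * c * dot a a <= E0 + dot a (z - xs)]. *)
Lemma mirror_test_of_large_kappa : exists K, 0 < K /\
  forall k lam kap yh, completed len k -> 0 < lam -> 0 < kap ->
    trial_point burg f rho (st k) lam kap yh ->
    smooth_test burg f (st k) lam kap yh -> K <= kap ->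
    mirror_test burg f entropy (st k) lam kap yh.
Proof.
have [b [B0 [b0 xsb zb xb]]] := trial_points_box.
pose B := Num.max B0 b.
have wB w : b <= w <= B0 -> b <= w <= B by move=> /andP[h1 h2]; rewrite h1 le_max h2.
have bB : b <= B by rewrite le_max lexx orbT.
have B_gt0 : 0 < B by exact: lt_le_trans bB.
pose Q := 2 * (B / b + 1); pose c := b ^+ 2 / (2 * Q).
have Q0 : 0 < Q by rewrite mulr_gt0// addr_gt0// divr_gt0.
have cp : 0 < c by rewrite divr_gt0 ?exprn_gt0// mulr_gt0.
pose A := E0 + \sum_(j < n) B ^+ 2 + 1.
have A1 : 1 <= A.
  rewrite /A lerDr addr_ge0 ?E0_ge0//.
  by apply: sumr_ge0 => j _; exact: sqr_ge0.
have BA0 : 0 < B * expR A by rewrite mulr_gt0// expR_gt0.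
exists ((2 + B * expR A) / c); split; first by rewrite divr_gt0// addr_gt0.
move=> k lam kap yh kc l0 k0 tp sm; rewrite ler_pdivrMr// => kapc.
have sA := adm kc; have [Oy _ _ z_int [w0 _ _]] := sA.
have Ox := trial_x_Omega SA sA l0 k0.
have Oyh := trial_yh_Omega SA sA l0 k0 tp.
have xp : positive (trial_x (st k) lam kap) by exact/Omega_burg.
have yhp : positive yh by exact/Omega_burg.
have zp := z_pos kc.
have al0 := trial_alpha_gt0 (st k) l0 k0.
have w'0 := trial_omega_gt0 sA l0 k0.
have alE := trial_alpha_sqr sA l0 k0.
have xyb := xb k lam kap yh kc l0 k0 tp sm.
have est := trial_estimate SA f_cvx sA l0 k0 tp xs_fin.1 xs_fin.2.
have prog := rprogress_ge SA sA l0 k0 tp sm.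
have mtE := mirror_testE SA phiL sA l0 k0 tp.
have dual : (dom (conjugate entropy))° (trial_dual burg entropy (st k) lam kap yh).
  exact: conjugate_entropy_interior.
have [zh_int zhE] := Legendre_grad_conjugate phiL dual.
have zhp := interior_dom_entropy zh_int.
have Df0 : 0 <= rbregman f (it_y (st k)) (trial_x (st k) lam kap).
  exact: (rbregman_ge0 (f_ninf SA) f_cvx (f_diff SA Ox) (f_fin SA Oy)).
set x := trial_x _ _ _ in Ox xp xyb est prog mtE Df0 *.
set w' := trial_omega _ _ _ in w'0 alE est mtE *.
set zh := grad _ _ in zh_int zhE zhp.
set P := rprogress _ _ _ _ _ in est prog mtE.
pose a := trial_alpha (st k) lam kap *: bpg_residual burg lam x yh.
set al := trial_alpha _ _ _ in al0 alE est a *.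
have aE j : a ord0 j = al * (lam^-1 * ((yh ord0 j)^-1 - (x ord0 j)^-1)).
  rewrite /a /bpg_residual (grad_burg (psi_diff SA Ox) xp).
  by rewrite (grad_burg (psi_diff SA Oyh) yhp) !mxE; ring.
pose S := \sum_(j < n) a ord0 j ^+ 2.
(* Here [x_j / yh_j - 1 = lam * x_j * g_j] turns the divergence into a quadratic
   form in [a], and [kap * alpha ^+ 2 = 2 * lam * omega'] into one scaled by
   [kap]. *)
have SP : kap * c * S <= w' * P.
  apply: (@le_trans _ _ (w' * (lam^-1 * rbregman burg x yh))); last first.
    by rewrite ler_pM2l.
  rewrite burg_divE// /burg_div /S !mulr_sumr; apply: ler_sum => j _.
  have [/wB/andP[xb1 xb2] /wB/andP[yb1 yb2]] := xyb j.
  have r0 : 0 < x ord0 j / yh ord0 j by rewrite divr_gt0.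
  have rB : x ord0 j / yh ord0 j <= B / b.
    by apply: ler_pM => //; [exact: ltW|rewrite invr_ge0 ltW|rewrite lef_pV2 ?posrE].
  have : (x ord0 j / yh ord0 j - 1) ^+ 2
      <= Q * (x ord0 j / yh ord0 j - 1 - ln (x ord0 j / yh ord0 j)).
    by apply: sqr_le_sub1_ln; rewrite r0.
  set X := _ - ln _ => thX.
  have th : al * (x ord0 j / yh ord0 j - 1) = lam * x ord0 j * a ord0 j.
    by rewrite aE; field; rewrite !gt_eqF.
  have w'E : w' * (lam^-1 * X) = kap * (al ^+ 2 * X) / (2 * lam ^+ 2).
    have -> : w' = kap * al ^+ 2 / (2 * lam) by rewrite alE; field; rewrite gt_eqF.
    by field; rewrite gt_eqF.
  rewrite w'E ler_pdivlMr ?mulr_gt0 ?exprn_gt0//.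
  have -> : kap * c * a ord0 j ^+ 2 * (2 * lam ^+ 2) =
      kap * ((lam * b * a ord0 j) ^+ 2 / Q).
    by rewrite /c; field; rewrite gt_eqF.
  rewrite ler_pM2l// ler_pdivrMr// -[leRHS]mulrA [X * Q]mulrC.
  apply: (@le_trans _ _ (al ^+ 2 * (x ord0 j / yh ord0 j - 1) ^+ 2)); last first.
    by rewrite ler_pM2l ?exprn_gt0.
  rewrite -exprMn th !exprMn ler_wpM2r ?sqr_ge0// ler_wpM2l ?sqr_ge0//.
  by rewrite ler_pXn2r ?nnegrE ?(ltW (xp j)) ?(ltW b0).
have S_le : S <= A - 1.
  have uyh : 0 <= w' * (rPhi f rho yh - rPhi f rho xs).
    rewrite mulr_ge0 ?(ltW w'0)// subr_ge0.
    have ryh := trial_yh_rho SA sA l0 k0 tp.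
    rewrite -lee_fin -!PhiE ?(f_fin SA Oyh) ?xs_fin.1 ?xs_fin.2//.
    by case: xs_min => _ /(_ _ (subset_closure Oyh)).
  have g0 := gap_le kc; rewrite /gap in g0.
  have lin : al * dot (bpg_residual burg lam x yh) (it_z (st k) - xs)
      <= S + \sum_(j < n) B ^+ 2.
    rewrite -dotZl -/a /dot /S -big_split /=; apply: ler_sum => j _.
    have /andP[zb1 zb2] := wB _ (zb k kc j); have /andP[ub1 ub2] := wB _ (xsb j).
    rewrite [(_ - xs) ord0 j]mxE [(- xs) ord0 j]mxE; move: (a ord0 j) => t.
    have : (it_z (st k) ord0 j - xs ord0 j) ^+ 2 <= B ^+ 2.
      rewrite -[leLHS]real_normK ?num_real// ler_pXn2r ?nnegrE ?(ltW B_gt0)//.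
      by rewrite ler_norml; apply/andP; split; lra.
    have := sqr_ge0 (t - (it_z (st k) ord0 j - xs ord0 j)).
    have := sqr_ge0 (t + (it_z (st k) ord0 j - xs ord0 j)).
    by move: (it_z (st k) ord0 j - xs ord0 j) => v; lra.
  have S0 : 0 <= S by apply: sumr_ge0 => j _; exact: sqr_ge0.
  have : 2 * S <= kap * c * S by rewrite ler_wpM2r//; lra.
  have := mulr_ge0 w0 Df0; rewrite /A; lra.
(* A coordinate that is very negative would make [expR (- a_j)] uncontrollable. *)
have aA j : - A <= a ord0 j.
  have : a ord0 j ^+ 2 <= S.
    by rewrite /S (bigD1 j)//= lerDl; apply: sumr_ge0 => i _; exact: sqr_ge0.
  by have := sqr_ge0 (a ord0 j + 1); nra.
apply/(mtE zh_int); split; first exact/Omega_burg.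
apply: (@le_trans _ _ (w' * P)); last by rewrite lerDl mulr_ge0.
apply: le_trans SP; apply: (@le_trans _ _ (B * expR A * S)); last first.
  apply: ler_wpM2r; first by apply: sumr_ge0 => j _; exact: sqr_ge0.
  by lra.
(* The mirror step is multiplicative: [zh_j = z_j * expR (- a_j)]. *)
have lnzh j : ln (zh ord0 j) = ln (it_z (st k) ord0 j) - a ord0 j.
  have := congr1 (fun v : 'rV[R]_n => v ord0 j) zhE.
  rewrite /trial_dual -/x -/al -/a (grad_entropy (phi_diff phiL zh_int) zhp).
  rewrite (grad_entropy (zdiff kc) zp) mxE => ->.
  by rewrite mxE [(- a) ord0 j]mxE mxE.
rewrite entropy_bregman//; last exact: (phi_diff phiL zh_int).
rewrite /S mulr_sumr; apply: ler_sum => j _; rewrite -mulrA.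
have /andP[zb1 zb2] := wB _ (zb k kc j).
have -> : zh ord0 j / it_z (st k) ord0 j = expR (- a ord0 j).
  rewrite -[LHS]lnK ?posrE ?divr_gt0//; congr expR.
  by rewrite ln_div ?posrE// lnzh; ring.
rewrite expRK opprK; apply: ler_pM => //.
- exact: ltW.
- by have := expR_ge1Dx (- a ord0 j); lra.
- by apply: expRN_quadratic => //; lra.
Qed.

(** Rejected trials with [kap] beyond [K] fail the smoothness test only. *)
Lemma tried_kap_le : exists K, forall k lam kap, completed len k ->
  tried burg f rho entropy gam_p gam_m gam_k (st k) lam kap ->
  kap <= Num.max (it_kap (st k)) K.
Proof.
have [K [K0 mt]] := mirror_test_of_large_kappa.
exists (gam_k * K) => k lam kap kc.
have sA := adm kc; have [_ _ _ _ [_ _ ks0]] := sA.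
have gk0 : 0 < gam_k by exact: lt_trans ltr01 gk1.
elim=> [|//|l q yh _ _ _ _ nd|l q yh tr IH tp sm _ nm].
- rewrite le_max ler_pdivrMr ?(lt_le_trans ltr01 gp1)//.
  by rewrite ler_peMr ?(ltW ks0).
- by case: nd; exact: conjugate_entropy_interior.
rewrite le_max ler_pM2l//; apply/orP; right.
have [l0 q0] := tried_gt0 gp1 gm1 gk1 sA tr.
by rewrite leNgt; apply/negP => /ltW Kq; case: nm; exact: mt.
Qed.

Lemma kap_bounded : exists K, forall k, completed len k -> it_kap (st k) <= K.
Proof.
have [K tK] := tried_kap_le.
exists (Num.max (it_kap (st 0%N)) K); elim=> [_|k IH kc].
  by rewrite le_max lexx.
have [_ [[tr _ _ _ _] _]] := run_step run kc.
have kc' := completed_pred kc.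
apply: le_trans (tK _ _ _ kc' tr) _.
by rewrite ge_max IH// le_max lexx orbT.
Qed.

End BurgEntropyRuns.

(** * Convergence rates of the accelerated method *)

Theorem mainTheorem1 (R : realType) (n : nat)
  (psi f rho phi : 'rV[R]_n -> \bar R) (y0 : 'rV[R]_n)
  (lam0 kap0 gam_p gam_m gam_k : R)
  (len : option nat) (st : nat -> iterate R n) :
  standing_assumptions psi f rho ->
  solvable psi f rho ->
  convex_efun f ->
  ga_inputs psi rho phi y0 lam0 kap0 gam_p gam_m gam_k ->
  ga_run psi f rho phi gam_p gam_m gam_k y0 lam0 kap0 len st ->
  [/\ forall N, (0 < N)%N -> completed len N ->
        forall u, (closure (Omega psi) `&` dom (Phi f rho) `&` dom phi) u ->
        (Phi f rho (it_y (st N)) - Phi f rho u <= rate_bound phi st N u)%E,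
      forall xs, is_minimizer psi f rho xs -> dom phi xs ->
        (forall N, (0 < N)%N -> completed len N ->
          (Phi f rho (it_y (st N)) - Phi f rho xs <= rate_bound phi st N xs)%E /\
          (Phi f rho (it_y (st N)) - Phi_star psi f rho
             <= rate_bound phi st N xs)%E) /\
        (forall c : R, 0 < c ->
          (forall k, (0 < k)%N -> completed len k ->
             c <= it_lam (st k) / it_kap (st k)) ->
          bigO_inv_sq len
            (fun N => Phi f rho (it_y (st N)) - Phi_star psi f rho)%E)
    & psi = burg -> phi = entropy ->
      (forall r : R,
         bounded_set (closure (Omega psi) `&` [set x | (Phi f rho x <= r%:E)%E])) ->
      (exists2 xs, is_minimizer psi f rho xs & Omega psi xs) ->
      (ereal_sup [set (it_kap (st k))%:E | k in [set k | completed len k]] < +oo)%E /\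
      bigO_inv_sq len
        (fun k => Phi f rho (it_y (st k)) - Phi_star psi f rho)%E].
Proof.
move=> SA _ f_cvx inputs run.
have phi_ninf : forall x, phi x != -oo%E by case: (phi_Legendre inputs) => -[].
split.
- move=> N N0 Nc u [[_ uPhi] uphi].
  exact: (run_rate_bound SA f_cvx inputs run N0 Nc uPhi uphi).
- move=> xs xs_min pxs.
  have xsPhi := minimizer_dom_Phi SA inputs run xs_min.
  split=> [N N0 Nc|c c0 cle]; last first.
    exact: (run_bigO SA f_cvx inputs run xs_min pxs c0 cle).
  rewrite (minimizer_Phi_star xs_min).
  by split; exact: (run_rate_bound SA f_cvx inputs run N0 Nc xsPhi pxs).
move=> psiE phiE bounded [xs xs_min xs_Omega]; subst psi phi.
have [K kapK] := kap_bounded SA f_cvx inputs run bounded xs_min xs_Omega.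
have [l l0 lamK] := lam_bounded_below SA inputs run.
split.
  apply: (@le_lt_trans _ _ K%:E); last exact: ltry.
  by apply: ge_ereal_sup => _ [k kc <-]; rewrite lee_fin; exact: kapK.
have xsp : dom entropy xs.
  have xs_pos : positive xs by exact/Omega_burg.
  by rewrite /dom /= entropyE ?ltry// => j; exact: ltW.
have K0 : 0 < K.
  have c0 : completed len 0 by case: len {run kapK lamK}.
  have [_ _ _ _ [_ _ k0]] := run_admissible SA inputs run c0.
  exact: lt_le_trans k0 (kapK _ c0).
apply: (run_bigO SA f_cvx inputs run xs_min xsp (c := l / K)).
  exact: divr_gt0.
move=> k _ kc; have [_ _ _ _ [_ lk0 kk0]] := run_admissible SA inputs run kc.
apply: ler_pM; rewrite ?invr_ge0 ?(ltW l0) ?(ltW K0) ?lamK//.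
by rewrite lef_pV2 ?posrE// kapK.
Qed.
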